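(* Let $\Omega\subset\mathbb R^n$ be open, $V$ a Banach space, and let $X(\Omega)$ be a Banach function space that has the Radon-Nikodým property. If $u\in X(\Omega;V)$ and there is a constant $C\in[0,\infty)$ such that $$\|\tau_{te_j}u-\tau_{se_j}u\|_{X(\omega;V)}\le C|t-s|,\qquad j\in\{1,\dots,n\},$$ for all $\omega\Subset\Omega$ and all $s,t\in\mathbb R$ with $\max\{|t|,|s|\}<\operatorname{dist}(\omega,\partial\Omega)$, then $u\in R^1X(\Omega;V)$, and there is a Reshetnyak upper gradient $g$ of $u$ such that $\|g\|_{X(\Omega)}\le nC$.
   Context: Banach spaces are real; $|A|$ is Lebesgue measure. $M(\Omega)$ is the set of real-valued measurable functions on $\Omega$ (identified when equal a.e.). A Banach space $X(\Omega)\subset M(\Omega)$ with norm $\|\cdot\|_X$ (put $\|f\|_X=\infty$ if $f\notin X(\Omega)$) is a Banach function space if: (P1) $|f|\le g$, $f\in M(\Omega)$, $g\in X(\Omega)$ imply $f\in X(\Omega)$ and $\|f\|_X\le\|g\|_X$; (P2) $0\le f_n\nearrow f$ a.e. implies $\|f_n\|_X\nearrow\|f\|_X$; (P3) $\chi_A\in X(\Omega)$ for every measurable $A\subset\Omega$ with $|A|<\infty$; (P4) for every measurable $A\subset\Omega$ with $|A|<\infty$ there is $C_A>0$ with $\int_A|f|\,dx\le C_A\|f\chi_A\|_X$ for all $f\in X(\Omega)$. For $h\in\mathbb R^n$, $\tau_hu(x)=u(x+h)$ if $x+h\in\Omega$ and $\tau_hu(x)=0$ otherwise; $e_j$ is the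 $j$-th standard basis vector. $X(\Omega;V)$ is the space of strongly measurable $u:\Omega\to V$ with $\|u(\cdot)\|_V\in X(\Omega)$, with norm $\|u\|_{X(\Omega;V)}=\big\|\|u(\cdot)\|_V\big\|_X$. For $\omega\subset\Omega$, $\|u\|_{X(\omega;V)}=\|u\chi_\omega\|_{X(\Omega;V)}$. $\omega\Subset\Omega$ means $\omega$ is open with compact closure contained in $\Omega$. $W^1X(\Omega)$ is the space of real-valued $u\in X(\Omega)$ whose weak (distributional) partial derivatives $\partial_ju$ exist as $L^1_{loc}$ functions and belong to $X(\Omega)$; $|\nabla u|=\big(\sum_{j=1}^n|\partial_ju|^2\big)^{1/2}$. $R^1X(\Omega;V)$ (Reshetnyak--Sobolev space) is the class of $u\in X(\Omega;V)$ such that: (A) $\langle v^*,u\rangle\in W^1X(\Omega)$ for every $v^*\in V^*$ with $\|v^*\|\le1$; (B) there is a non-negative $g\in X(\Omega)$ such that for every $v^*\in V^*$ with $\|v^*\|\le 1$, $|\nabla\langle v^*,u\rangle|\le g$ a.e. on $\Omega$. Such a $g$ is called a Reshetnyak upper gradient of $u$. A Banach space $E$ has the Radon-Nikodým property if for every $\sigma$-finite complete measure space $(S,\Sigma,\mu)$ and every $E$-valued measure $\nu$ on $\Sigma$ of bounded variation that is absolutely continuous with respect to $\mu$ there is $f\in L^1(S;E)$ with $\nu(A)=\int_Af\,d\mu$ for all $A\in\Sigma$. Equivalently, every locally Lipschitz function $\mathbb R\to E$ is differentiable a.e. *)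

(* Defs.v *)
From HB Require Import structures.
From mathcomp Require Import all_boot all_order all_algebra.
From mathcomp Require Import all_classical all_reals all_analysis.

Set Implicit Arguments.
Unset Strict Implicit.
Unset Printing Implicit Defensive.

Import Order.TTheory GRing.Theory Num.Theory.
Import numFieldNormedType.Exports.

Local Open Scope classical_set_scope.
Local Open Scope ring_scope.

(* R^n is 'rV[R]_n.+1 with n the dimension minus one. The library puts the sup
   norm on it, which gives the usual topology; Euclidean lengths use enorm. *)
Section euclidean.
Context {R : realType} {n : nat}.
Implicit Types (x y a b : 'rV[R]_n.+1) (A B : set 'rV[R]_n.+1).

Definition enorm x : R := Num.sqrt (\sum_(i < n.+1) x 0 i ^+ 2).

Definition stdvec (j : 'I_n.+1) : 'rV[R]_n.+1 := delta_mx 0 j.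

Definition boundary A : set 'rV[R]_n.+1 := closure A `\` interior A.

(* +oo when A or B is empty *)
Definition set_dist A B : \bar R :=
  ereal_inf [set r | exists x y, [/\ A x, B y & r = (enorm (x - y))%:E]].

Definition compactly_contained A B :=
  [/\ open A, compact (closure A) & closure A `<=` B].

Definition box a b : set 'rV[R]_n.+1 :=
  [set x | forall i, a 0 i < x 0 i <= b 0 i].

Definition box_cover A (ab : nat -> 'rV[R]_n.+1 * 'rV[R]_n.+1) :=
  (forall k i, (ab k).1 0 i <= (ab k).2 0 i) /\
  A `<=` \bigcup_k box (ab k).1 (ab k).2.

Definition box_vol (ab : 'rV[R]_n.+1 * 'rV[R]_n.+1) : R :=
  \prod_(i < n.+1) (ab.2 0 i - ab.1 0 i).

End euclidean.

Section lebesgue_outer_measure.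
Context (R : realType) (n : nat).
Local Open Scope ereal_scope.
Implicit Types A B : set 'rV[R]_n.+1.

Definition leb_outer A : \bar R :=
  ereal_inf [set \sum_(0 <= k <oo) (box_vol (ab k))%:E | ab in box_cover A].

Lemma box_vol_ge0 A ab k : box_cover A ab -> 0 <= (box_vol (ab k))%:E.
Proof.
move=> [h _]; rewrite lee_fin; apply: prodr_ge0 => i _.
by rewrite subr_ge0.
Qed.

Lemma leb_outer_ge0 A : 0 <= leb_outer A.
Proof.
apply/le_ereal_inf_tmp => _ [ab hab <-].
by apply: nneseries_ge0 => k _ _; exact: box_vol_ge0 hab.
Qed.

Lemma leb_outer0 : leb_outer set0 = 0.
Proof.
apply/eqP; rewrite eq_le leb_outer_ge0 andbT.
apply: ereal_inf_lbound; exists (fun=> (0%R, 0%R)).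
  by split => // k i; rewrite lexx.
rewrite eseries0// => k _ _.
by rewrite /box_vol /= big_ord_recl subrr mul0r.
Qed.

Lemma le_leb_outer : {homo leb_outer : A B / A `<=` B >-> A <= B}.
Proof.
move=> A B AB; apply: ereal_inf_le_tmp => _ [ab [h1 h2] <-].
by exists ab => //; split => //; exact: subset_trans AB h2.
Qed.

Lemma leb_outer_sigma_subadditive : sigma_subadditive leb_outer.
Proof.
move=> A; have [[i ioo]|] := pselect (exists i, leb_outer (A i) = +oo).
  rewrite (eseries_pinfty _ _ ioo) ?leey// => k _.
  by rewrite -ltNye (lt_le_trans _ (leb_outer_ge0 _)).
rewrite -forallNE => Afin.
apply/lee_addgt0Pr => _/posnumP[e].
rewrite (le_trans _ (epsilon_trick _ _ _))//; last first.
  by move=> k; exact: leb_outer_ge0.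
pose P i (G : nat -> 'rV[R]_n.+1 * 'rV[R]_n.+1) := box_cover (A i) G /\
  \sum_(0 <= k <oo) (box_vol (G k))%:E <=
  leb_outer (A i) + (e%:num / (2 ^ i.+1)%:R)%:E.
have [G PG] : {G & forall i, P i (G i)}.
  apply: (@choice _ _ P) => i; rewrite /P.
  have fin : leb_outer (A i) \is a fin_num.
    by rewrite ge0_fin_numE ?leb_outer_ge0// ltey; apply/eqP; exact: Afin.
  have e0 : (0 < e%:num / (2 ^ i.+1)%:R :> R)%R.
    by rewrite divr_gt0// ltr0n expn_gt0.
  have [_ [ab hab <-] /ltW hle] := lb_ereal_inf_adherent e0 fin.
  by exists ab; split.
pose F := uncurry G.
have F0 x : 0 <= ((EFin \o (@box_vol R n)) \o F) x.
  by case: x => i k /=; exact: box_vol_ge0 (PG i).1.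
apply: (@le_trans _ _ (\esum_(x in setT) ((EFin \o (@box_vol R n)) \o F) x)).
  rewrite /leb_outer; apply: ereal_inf_lbound => /=.
  have /card_esym/ppcard_eqP[f] := card_nat2.
  exists (F \o f).
    split => [k i|]; first by rewrite /F /= /uncurry; case: (f k) => p q; exact: (PG p).1.1.
    move=> t [i _ Ait]; have [j _ Bt] := (PG i).1.2 _ Ait.
    exists (f^-1%FUN (i, j)) => //=.
    by rewrite invK ?inE.
  rewrite -(esum_pred_image ((EFin \o (@box_vol R n)) \o F) _ xpredT)
    ?[fun=> _]set_true//.
  by rewrite image_eq.
rewrite (_ : esum _ _ =
    \sum_(0 <= i <oo) \sum_(0 <= j <oo) (box_vol (G i j))%:E); last first.
  pose J : nat -> set (nat * nat) := fun i => [set (i, j) | j in setT].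
  rewrite (_ : setT = \bigcup_k J k); last first.
    by rewrite predeqE => -[a b]; split => // _; exists a => //; exists b.
  rewrite esum_bigcupT /=; last 2 first.
    - apply/trivIsetP => i j _ _ ij.
      rewrite predeqE => -[p m] /=; split => //= -[] [_] _ [<-{p} _].
      by move=> [m' _] [] /esym/eqP; rewrite (negbTE ij).
    - exact: F0.
  rewrite -(image_id [set: nat]) -fun_true esum_pred_image//; last first.
    by move=> k _; apply: esum_ge0 => x _; exact: F0.
  apply: eq_eseriesr => /= j _.
  rewrite -(esum_pred_image (fun x => (box_vol (F x))%:E) (pair j) predT)//=;
    last 2 first.
  - by move=> k _; exact: (F0 (j, k)).
  - by move=> ? ? _ _; exact: (@can_inj _ _ _ snd).
  by congr esum; rewrite predeqE => -[a b]; split; move=> [i _ <-]; exists i.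
apply: lee_lim.
- apply: is_cvg_nneseries => k *.
  by apply: nneseries_ge0 => m *; exact: (F0 (k, m)).
- by apply: is_cvg_nneseries => k *; apply: adde_ge0 => //; exact: leb_outer_ge0.
- by near=> k; apply: lee_sum => i _; exact: (PG i).2.
Unshelve. all: by end_near. Qed.

HB.instance Definition _ := isOuterMeasure.Build R 'rV[R]_n.+1 leb_outer
  leb_outer0 leb_outer_ge0 le_leb_outer leb_outer_sigma_subadditive.

(* R^n with the sigma-algebra of Lebesgue measurable sets *)
Definition lebspace : measurableType leb_outer.-cara :=
  caratheodory_type leb_outer.

Definition lebn : set lebspace -> \bar R := leb_outer.

HB.instance Definition _ := isMeasure.Build _ lebspace R lebn
  (@caratheodory_measure0 _ _ leb_outer)
  (@caratheodory_measure_ge0 _ _ leb_outer)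
  (@caratheodory_measure_sigma_additive _ _ leb_outer).

End lebesgue_outer_measure.

Section bochner.
Context d (S : measurableType d) (R : realType).
Context (mu : {measure set S -> \bar R}) (E : normedModType R).
Implicit Types (f s : S -> E) (A D : set S).

Definition simple_function s :=
  finite_set (range s) /\ forall v, measurable (s @^-1` [set v]).

Definition strongly_measurable D f := exists s_ : nat -> S -> E,
  (forall k, simple_function (s_ k)) /\
  {ae mu, forall x, D x -> s_ ^~ x @ \oo --> f x}.

Definition integrable_simple s :=
  simple_function s /\ forall v, v != 0 -> (mu (s @^-1` [set v]) < +oo)%E.

Definition simple_integral A s : E :=
  \sum_(v \in range s) fine (mu (A `&` s @^-1` [set v])) *: v.

(* the Bochner integral of f over A exists and equals e *)
Definition is_bochner_integral A f (e : E) := exists s_ : nat -> S -> E,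
  [/\ forall k, integrable_simple (s_ k),
      {ae mu, forall x, A x -> s_ ^~ x @ \oo --> f x},
      (\int[mu]_(x in A) `|f x - s_ k x|%:E)%E @[k --> \oo] --> 0%E &
      simple_integral A (s_ k) @[k --> \oo] --> e].

Definition bochner_L1 f :=
  strongly_measurable setT f /\ (\int[mu]_x `|f x|%:E < +oo)%E.

Definition vector_measure (nu : set S -> E) :=
  forall F : nat -> set S, (forall i, measurable (F i)) -> trivIset setT F ->
    series (nu \o F) @ \oo --> nu (\bigcup_i F i).

Definition vector_variation (nu : set S -> E) : \bar R :=
  ereal_sup [set r | exists (k : nat) (F : 'I_k -> set S),
    [/\ forall i, measurable (F i), trivIset setT F, \bigcup_i F i = setT &
        r = (\sum_(i < k) `|nu (F i)|)%:E]].

Definition absolutely_continuous (nu : set S -> E) :=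
  forall A, measurable A -> mu A = 0 -> nu A = 0.

End bochner.

Definition radon_nikodym_property (R : realType) (E : completeNormedModType R) :=
  forall (d : measure_display) (S : measurableType d)
    (mu : {measure set S -> \bar R}) (nu : set S -> E),
  sigma_finite setT mu -> measure_is_complete mu ->
  vector_measure nu -> (vector_variation nu < +oo)%E ->
  absolutely_continuous mu nu ->
  exists f : S -> E, bochner_L1 mu f /\
    forall A, measurable A -> is_bochner_integral mu A f (nu A).

(* Elements of M(Omega), and V-valued functions on Omega, are represented by
   total functions on R^n, whose values outside Omega are irrelevant. *)
Section function_space.
Context (R : realType) (n : nat) (Omega : set 'rV[R]_n.+1).
Local Notation T := 'rV[R]_n.+1.
Local Notation mu := (@lebn R n).

Definition measurable_on (D : set T) (f : T -> R) :=
  measurable_fun (D : set (lebspace R n)) (f : lebspace R n -> R).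

Definition ae_on (P : T -> Prop) :=
  {ae mu, forall x : lebspace R n, Omega x -> P x}.

(* A Banach space X(Omega) contained in M(Omega) is given by an abstract Banach
   space X and a map emb sending each element to a representative of its
   a.e. class; emb is required below to be linear and injective modulo a.e.
   equality. *)
Section embedding.
Context (X : completeNormedModType R) (emb : X -> T -> R).

Definition Xmem (f : T -> R) := exists phi : X, ae_on (fun x => emb phi x = f x).

(* the infimum is over a set with at most one element, and is +oo when f is not
   in X(Omega) *)
Definition Xnorm (f : T -> R) : \bar R :=
  ereal_inf [set `|phi|%:E | phi in [set phi : X | ae_on (fun x => emb phi x = f x)]].

Record banach_function_space : Prop := BanachFunctionSpace {
  emb_measurable : forall phi, measurable_on Omega (emb phi) ;
  emb_linear : forall a phi psi,
    ae_on (fun x => emb (a *: phi + psi) x = a * emb phi x + emb psi x) ;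
  emb_inj : forall phi, ae_on (fun x => emb phi x = 0) -> phi = 0 ;
  bfs_P1 : forall f g, measurable_on Omega f -> Xmem g ->
    ae_on (fun x => `|f x| <= g x) -> Xmem f /\ (Xnorm f <= Xnorm g)%E ;
  bfs_P2 : forall (f_ : nat -> T -> R) f,
    (forall k, measurable_on Omega (f_ k)) -> measurable_on Omega f ->
    ae_on (fun x => [/\ forall k, 0 <= f_ k x,
      {homo f_ ^~ x : k m / (k <= m)%N >-> k <= m} & f_ ^~ x @ \oo --> f x]) ->
    {homo Xnorm \o f_ : k m / (k <= m)%N >-> (k <= m)%E} /\
    Xnorm \o f_ @ \oo --> Xnorm f ;
  bfs_P3 : forall A : set (lebspace R n), measurable A -> A `<=` Omega ->
    (mu A < +oo)%E -> Xmem \1_A ;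
  bfs_P4 : forall A : set (lebspace R n), measurable A -> A `<=` Omega ->
    (mu A < +oo)%E -> exists2 C : R, 0 < C & forall f, Xmem f ->
      (\int[mu]_(x in A) `|f x|%:E <= C%:E * Xnorm (fun x => f x * \1_A x)%R)%E
}.

Section vector_valued.
Context (V : completeNormedModType R).
Implicit Types u : T -> V.

Definition translation (h : T) u (x : T) : V :=
  if x + h \in Omega then u (x + h) else 0.

Definition XVmem u :=
  strongly_measurable mu (Omega : set (lebspace R n)) (u : lebspace R n -> V) /\
  Xmem (fun x => `|u x|).

Definition XVnorm u : \bar R := Xnorm (fun x => `|u x|).

Definition XVnorm_on (omega : set T) u : \bar R :=
  XVnorm (fun x => \1_omega x *: u x).

End vector_valued.

End embedding.

Fixpoint Ck (k : nat) (phi : T -> R) : Prop :=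
  match k with
  | 0 => continuous phi
  | k'.+1 => continuous phi /\ forall j : 'I_n.+1,
      (forall x, derivable phi x (stdvec j)) /\ Ck k' ('D_(stdvec j) phi)
  end.

(* C_c^oo(Omega), extended by 0 to R^n *)
Definition test_function (phi : T -> R) :=
  [/\ forall k, Ck k phi, compact (closure [set x | phi x != 0]) &
      closure [set x | phi x != 0] `<=` Omega].

Definition L1loc (f : T -> R) := measurable_on Omega f /\
  forall K : set T, compact K -> K `<=` Omega ->
    mu.-integrable (K : set (lebspace R n)) (EFin \o f).

Definition weak_partial (j : 'I_n.+1) (f w : T -> R) := L1loc w /\
  forall phi, test_function phi ->
    (\int[mu]_(x in Omega) (f x * 'D_(stdvec j) phi x) =
     - \int[mu]_(x in Omega) (w x * phi x))%R.

Definition weak_gradient (f : T -> R) (Df : T -> T) :=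
  forall j, weak_partial j f (fun x => Df x 0 j).

Section sobolev.
Context (X : completeNormedModType R) (emb : X -> T -> R).

Definition W1X (f : T -> R) := Xmem emb f /\
  exists Df, weak_gradient f Df /\ forall j, Xmem emb (fun x => Df x 0 j).

Context (V : completeNormedModType R).

Definition dual_norm (l : V -> R) : \bar R :=
  ereal_sup [set `|l v|%:E | v in [set v : V | `|v| <= 1]].

Definition dual_unit_ball (l : {linear V -> R^o}) :=
  continuous l /\ (dual_norm l <= 1)%E.

(* weak gradients are a.e. unique, so it does not matter which one is used *)
Definition reshetnyak_upper_gradient (u : T -> V) (g : T -> R) :=
  [/\ Xmem emb g, forall x, Omega x -> 0 <= g x &
      forall l, dual_unit_ball l -> exists Dlu,
        weak_gradient (l \o u) Dlu /\ ae_on (fun x => enorm (Dlu x) <= g x)].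

Definition R1X (u : T -> V) :=
  [/\ XVmem emb u,
      forall l, dual_unit_ball l -> W1X (l \o u) &
      exists g, reshetnyak_upper_gradient u g].

End sobolev.

End function_space.

(* Main.v *)
Require Import Defs.
From HB Require Import structures.
From mathcomp Require Import all_boot all_order all_algebra.
From mathcomp Require Import all_classical all_reals all_analysis.
From mathcomp Require Import measurable_realfun.
From mathcomp Require Import ring lra.

Import Order.TTheory GRing.Theory Num.Theory.
Import numFieldNormedType.Exports.

Local Open Scope classical_set_scope.
Local Open Scope ring_scope.

(** Write [D_k f = 2^k (f(. + 2^-k e_j) - f)] for the difference quotients of a
    component [f = <v*, u>], extended by zero outside Omega. On a subdomain
    omega the truncated translates [t |-> chi_omega (f(. + t e_j) - f)] form a
    Lipschitz path G in X. The increments of G define an X-valued measure on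
    the line, whose Radon-Nikodym density is approximated by a simple function;
    averaging over the base point t then shows that the difference quotients of
    G at scales 2^-k and 2^-k' are close in X for at least one t. By (P4) and
    the translation invariance of Lebesgue measure the value of t is irrelevant
    in L^1, so (D_k f) is Cauchy in L^1_loc. No pointwise differentiability of
    G is needed. The limit w of (D_k f) is the weak derivative of f.

    For finitely many functionals, [max_i |D_k f_i|] is bounded by
    [2^k |u(. + 2^-k e_j) - u|], so by the Fatou property of X the maximum of
    the corresponding [|w_i|] has norm at most C. The essential supremum of
    [|w_v*|] over the dual unit ball is reached along a sequence of such finite
    maxima; it is a function g_j with norm at most C, and the sum of the g_j is
    the upper gradient. *)

Set Implicit Arguments.
Unset Strict Implicit.
Unset Printing Implicit Defensive.

(** * Dyadic approximation on the line *)

(* The Radon-Nikodym property is stated for complete measure spaces, hence the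
   completed Lebesgue measure, on Caratheodory measurable sets. Only the part
   of the line in ]0, 2] matters: base points in [0, 1], steps at most 1. *)
Section dyadic.
Context (R : realType).
Notation mu := (@completed_lebesgue_measure R).
Notation S := (caratheodory_type (wlength (@idfun R))^*%mu).
Implicit Types (A B : set S) (a b : R).

(** A derivative of [G] at a point is tied to exceptional null sets of the line, whereas two scales
    need only be compared at one good base point; averaging over the nodes [i 2^-k'] of [0, 1]
    produces one. At a node the quotient at scale 2^-k is the mean of the density over a window of
    length 2^-k, and the quotient at scale 2^-k' is its mean over the first cell of that window. For
    a simple density only the masses of its fibers in windows and cells matter. Two facts remain:
    the increments of [G] define a measure on all measurable sets, and window means of an indicator
    approach its cell means. Both state that an error between two scales, subadditive and dominated
    by Lebesgue measure, tends to 0. On rays this is an explicit computation; one pi-lambda argument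
    extends it. The dual ball is in general uncountable, and a pointwise supremum of representatives
    may fail to be measurable and depends on their choice; hence an essential supremum. The
    dimension enters the final bound because a Euclidean norm is estimated by the sum of the
    coordinates, each contributing at most [C]. *)

Definition dlen (k : nat) : R := (2 ^+ k)^-1.

Lemma dlen_gt0 k : 0 < dlen k.
Proof. by rewrite invr_gt0 exprn_gt0. Qed.

Lemma dlenD k m : dlen (k + m) = dlen k * dlen m.
Proof. by rewrite /dlen exprD invfM. Qed.

Lemma dlenE k m : (k <= m)%N -> dlen k = (2 ^ (m - k))%:R * dlen m.
Proof.
move=> km; rewrite -{2}(subnK km) /dlen exprD invfM natrX mulrA divff ?mul1r//.
Qed.

Definition lam A : R := fine (mu (A `&` `]0, 2]%classic)).

Lemma borel_completed (A : set (measurableTypeR R)) :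
  measurable A -> measurable (A : set S).
Proof. by move=> mA; apply: sub_caratheodory; exact: mA. Qed.

Lemma measurable_itvS (i : interval R) : measurable ([set` i] : set S).
Proof. by apply: borel_completed; exact: measurable_itv. Qed.

Lemma mu_itv a b : a <= b -> mu (`]a, b]%classic : set S) = (b - a)%:E.
Proof.
move=> ab; rewrite [LHS](_ : _ = lebesgue_measure (`]a, b]%classic : set R))//.
by rewrite lebesgue_measure_itv /= lte_fin; case: ltgtP ab => // ->; rewrite subrr.
Qed.

Lemma lam_fin A : measurable A -> mu (A `&` `]0, 2]%classic) \is a fin_num.
Proof.
move=> mA; rewrite ge0_fin_numE//.
apply: (@le_lt_trans _ _ (mu (`]0%R, 2%R]%classic : set S))); last first.
  by rewrite mu_itv// ltry.
apply: le_measure; rewrite ?inE//; [|exact: measurable_itvS].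
by apply: measurableI => //; exact: measurable_itvS.
Qed.

Lemma lam_ge0 A : 0 <= lam A.
Proof. by rewrite fine_ge0. Qed.

Lemma le_lam A B : measurable A -> measurable B -> A `<=` B -> lam A <= lam B.
Proof.
move=> mA mB AB; rewrite fine_le ?lam_fin// le_measure ?inE//.
- by apply: measurableI => //; exact: measurable_itvS.
- by apply: measurableI => //; exact: measurable_itvS.
- exact: setSI.
Qed.

Lemma lamU A B : measurable A -> measurable B -> A `&` B = set0 ->
  lam (A `|` B) = lam A + lam B.
Proof.
move=> mA mB AB; rewrite /lam setIUl measureU.
- by rewrite fineD ?lam_fin.
- by apply: measurableI => //; exact: measurable_itvS.
- by apply: measurableI => //; exact: measurable_itvS.
- by rewrite setIACA AB set0I.
Qed.

Lemma lamD A B : measurable A -> measurable B -> B `<=` A ->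
  lam (A `\` B) = lam A - lam B.
Proof.
move=> mA mB BA; have -> : lam A = lam (A `\` B) + lam B.
  rewrite -lamU//; [|exact: measurableD|by rewrite setDE -setIA setICl setI0].
  by rewrite setUC setDUK.
by rewrite addrK.
Qed.

Lemma lam0 A : mu A = 0%E -> measurable A -> lam A = 0.
Proof.
move=> A0 mA; rewrite /lam (_ : mu _ = 0%E)//; apply/eqP.
rewrite -measure_le0 -A0 le_measure ?inE//.
by apply: measurableI => //; exact: measurable_itvS.
Qed.

(* The pi-lambda theorem for families of seminorm-like set functions; it is
   applied to errors of dyadic approximation at scales 2^-k and 2^-k'. *)
Lemma dyadic_error_cvg0 (c : R) (p : nat -> nat -> set S -> R) : 0 <= c ->
  (forall k k' A, (k <= k')%N -> measurable A -> p k k' A <= c * lam A) ->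
  (forall k k' A B, (k <= k')%N -> measurable A -> measurable B ->
     A `&` B = set0 -> p k k' (A `|` B) <= p k k' A + p k k' B) ->
  (forall k k' A B, (k <= k')%N -> measurable A -> measurable B ->
     B `<=` A -> p k k' (A `\` B) <= p k k' A + p k k' B) ->
  (forall b e, 0 < e -> exists N, forall k k', (N <= k)%N -> (k <= k')%N ->
     p k k' `]b, +oo[%classic <= e) ->
  forall A, measurable A -> forall e, 0 < e ->
    exists N, forall k k', (N <= k)%N -> (k <= k')%N -> p k k' A <= e.
Proof.
move=> c0 plam pU pD pray.
pose H : set (set R) := [set A | measurable (A : set S) /\
  forall e, 0 < e ->
    exists N, forall k k', (N <= k)%N -> (k <= k')%N -> p k k' A <= e].
have HU (A B : set S) : H A -> H B -> A `&` B = set0 -> H (A `|` B).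
  move=> [mA hA] [mB hB] AB; split; first exact: measurableU.
  move=> e e0; have e20 : 0 < e / 2 by rewrite divr_gt0.
  have [N1 h1] := hA _ e20; have [N2 h2] := hB _ e20.
  exists (maxn N1 N2) => k k'; rewrite geq_max => /andP[k1 k2] kk'.
  by rewrite (le_trans (pU _ _ _ _ _ _ _ _))// [leRHS]splitr lerD// ?h1 ?h2.
have HD (A B : set S) : B `<=` A -> H A -> H B -> H (A `\` B).
  move=> BA [mA hA] [mB hB]; split; first exact: measurableD.
  move=> e e0; have e20 : 0 < e / 2 by rewrite divr_gt0.
  have [N1 h1] := hA _ e20; have [N2 h2] := hB _ e20.
  exists (maxn N1 N2) => k k'; rewrite geq_max => /andP[k1 k2] kk'.
  by rewrite (le_trans (pD _ _ _ _ _ _ _ _))// [leRHS]splitr lerD// ?h1 ?h2.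
have H0 (A : set S) : measurable A -> lam A = 0 -> H A.
  move=> mA A0; split=> // e e0; exists 0 => k k' _ kk'.
  by rewrite (le_trans (plam _ _ _ _ _))// A0 mulr0 ltW.
have Hray b : H `]b, +oo[%classic by split; [exact: measurable_itvS|exact: pray].
(* The whole line is the ray from 0 together with a set on which [lam] vanishes. For an increasing
   union, the part beyond [F i] has small [lam], hence an error that is small at all scales at once;
   [c + 1] in place of [c] keeps the divisor positive. *)
have lsys : lambda_system setT H.
  split=> //.
  - rewrite -(setvU `]0%R, +oo[%classic); apply: HU => //; last exact: setICl.
    apply: H0; first by apply: measurableC; exact: measurable_itvS.
    rewrite /lam (_ : _ `&` _ = set0) ?measure0//.
    by apply/seteqP; split => // x [] /=; rewrite !in_itv/= andbT => /negP; lra.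
  - move=> F ndF HF; have mF i : measurable (F i : set S) by case: (HF i).
    have mUF : measurable (\bigcup_i F i : set S) by exact: bigcupT_measurable.
    split=> // e e0.
    have lF : lam \o F @ \oo --> lam (\bigcup_i F i).
      apply: fine_cvg; rewrite fineK ?lam_fin// setI_bigcupl.
      apply: nondecreasing_cvg_mu.
      - by move=> i; apply: measurableI => //; exact: measurable_itvS.
      - by apply: bigcupT_measurable => i; apply: measurableI => //;
          exact: measurable_itvS.
      - by move=> i j ij; apply/subsetPset; apply: setSI; apply/subsetPset; exact: ndF.
    have d0 : 0 < e / (2 * (c + 1)).
      by rewrite divr_gt0// mulr_gt0// ltr_wpDl.
    move/cvgrPdist_lt/(_ _ d0): lF => [i _ /(_ i (leqnn _))/=]; rewrite -lamD//.
      rewrite ger0_norm ?lam_ge0// => li.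
      have e20 : 0 < e / 2 by rewrite divr_gt0.
      have [N hN] := (HF i).2 _ e20; exists N => k k' Nk kk'.
      rewrite -[X in p k k' X](@setDUK _ (F i))//; last exact: bigcup_sup.
      rewrite (le_trans (pU _ _ _ _ _ _ _ _))//.
      - exact: measurableD.
      - by rewrite setDE setICA setICr setI0.
      rewrite [leRHS]splitr lerD ?hN//.
      rewrite (le_trans (plam _ _ _ _ _))//; first exact: measurableD.
      rewrite (@le_trans _ _ ((c + 1) * (e / (2 * (c + 1)))))//.
        by rewrite ler_pM ?lam_ge0// ?lerDl// ltW.
      have c1 : c + 1 != 0 by rewrite gt_eqF// ltr_wpDl.
      by rewrite [leLHS](_ : _ = e / 2)//; field.
    exact: bigcup_sup.
have HB (A : set R) : <<s (@ocitv R) >> A -> H A.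
  rewrite [X in X A](RGenOInfty.measurableE R); apply: lambda_system_subset => //.
  - move=> _ _ [x ->] [y ->]; exists (Num.max x y); apply/seteqP; split => z /=;
    by rewrite !in_itv/= !andbT gt_max => /andP.
  - by move=> _ [x ->].
(* A set of the completion is a Borel set together with a subset of a Borel null set [M]; measurable
   subsets of [M] belong to [H] by the bound through [lam]. *)
move=> A; rewrite -[X in X -> _]/(((wlength (@idfun R))^*%mu.-cara).-measurable A).
rewrite -completed_caratheodory_measurable g_sigma_completed_algebra_genE.
move=> [B mB [N [M [mM M0 NM]] <-{A}]].
have HM (P : set S) : measurable P -> P `<=` M -> H P.
  move=> mP PM; apply: H0 => //; apply: lam0 => //.
  by apply/eqP; rewrite -measure_le0 -[leRHS]M0 le_outer_measure.
have mB' : measurable (B : set S) by exact: borel_completed.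
suff: H (B `|` (N `\` B)).
  rewrite (_ : B `|` (N `\` B) = B `|` N); first by case.
  by rewrite [LHS]setUDr setDv setD0.
apply: HU; [exact: HB| |by rewrite setDE setICA setICr setI0].
apply: HM; last by apply: subset_trans NM; exact: subDsetl.
apply: measurableD => //; apply: completed_lebesgue_measure_is_complete.
by exists M; split=> //; exact: borel_completed.
Qed.
End dyadic.
Arguments dlen {R}.
Arguments dlen_gt0 {R}.
Arguments dlenD {R}.
Arguments dlenE {R}.
Arguments lam {R}.

(** * Dyadic approximations of the measure of a Lipschitz path *)

Section dyadic_measure.
Context (R : realType).
Notation mu := (@completed_lebesgue_measure R).
Notation S := (caratheodory_type (wlength (@idfun R))^*%mu).
Implicit Types (A B : set S) (a b : R).

Definition cell (k i : nat) : set S := `]i%:R * dlen k, i.+1%:R * dlen k]%classic.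

Definition mass k i A : R := lam (A `&` cell k i).

Lemma measurable_cell k i : measurable (cell k i).
Proof. exact: measurable_itvS. Qed.

Lemma mass_ge0 k i A : 0 <= mass k i A.
Proof. exact: lam_ge0. Qed.

Lemma massU k i A B : measurable A -> measurable B -> A `&` B = set0 ->
  mass k i (A `|` B) = mass k i A + mass k i B.
Proof.
move=> mA mB AB; rewrite /mass setIUl lamU//.
- exact/measurableI/measurable_cell.
- exact/measurableI/measurable_cell.
- by rewrite setIACA AB set0I.
Qed.

Lemma massD k i A B : measurable A -> measurable B -> B `<=` A ->
  mass k i (A `\` B) = mass k i A - mass k i B.
Proof.
move=> mA mB BA; apply/eqP; rewrite eq_sym subr_eq -massU//.
- by rewrite setUC setDUK.
- exact: measurableD.
- by rewrite setDE -setIA setICl setI0.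
Qed.

Definition cells (k a q : nat) : set S :=
  `]a%:R * dlen k, (a + q)%N%:R * dlen k]%classic.

Lemma measurable_cells (k a q : nat) : measurable (cells k a q).
Proof. exact: measurable_itvS. Qed.

Lemma cells_cat k (a q : nat) :
  cells k a q.+1 = cells k a q `|` cell k (a + q).
Proof.
have d0 := @dlen_gt0 R k; rewrite /cells /cell -addnS.
have h1 : (a%:R : R) * dlen k <= (a + q)%N%:R * dlen k.
  by rewrite ler_pM2r// ler_nat leq_addr.
have h2 : ((a + q)%N%:R : R) * dlen k <= (a + q.+1)%N%:R * dlen k.
  by rewrite ler_pM2r// ler_nat addnS.
apply/seteqP; split=> x /=; rewrite !in_itv/=; last by case; lra.
by case: (leP x ((a + q)%N%:R * dlen k)) => h /andP[h3 h4]; [left|right];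
  rewrite ?h3 ?h ?h4.
Qed.

Lemma cells_disj k (a q : nat) :
  cells k a q `&` cell k (a + q) = set0.
Proof.
by apply/seteqP; split=> x //= []; rewrite /cells /cell/= !in_itv/=; lra.
Qed.

Lemma cells_nil k (a : nat) : cells k a 0 = set0.
Proof.
by rewrite /cells addn0; apply/seteqP; split=> x //=; rewrite in_itv/=; lra.
Qed.

Lemma sum_mass k (a q : nat) A : measurable A ->
  \sum_(i < q) mass k (a + i)%N A =
  lam (A `&` cells k a q).
Proof.
move=> mA; elim: q => [|q IH].
  by rewrite big_ord0 cells_nil setI0 lam0.
rewrite big_ord_recr/= IH -lamU//.
- by rewrite cells_cat setIUr.
- exact/measurableI/measurable_cells.
- exact/measurableI/measurable_cell.
- by rewrite setIACA cells_disj setI0.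
Qed.

Lemma sum_mass_le k (a q : nat) A : measurable A ->
  \sum_(i < q) mass k (a + i)%N A <= lam A.
Proof.
move=> mA; rewrite sum_mass// le_lam//.
exact/measurableI/measurable_cells.
Qed.

Lemma dlen2 k : (2 ^ k.+1)%:R * dlen k = 2 :> R.
Proof. by rewrite /dlen natrX exprS -mulrA divff ?mulr1// expf_neq0. Qed.

Lemma node_le2 k i : (i <= 2 ^ k.+1)%N -> i%:R * dlen k <= 2 :> R.
Proof. by move=> ik; rewrite -(dlen2 k) ler_pM2r ?dlen_gt0// ler_nat. Qed.

Lemma node_ge0 k i : 0 <= i%:R * dlen k :> R.
Proof. by rewrite mulr_ge0// ltW// dlen_gt0. Qed.

Lemma lam_itv a b : 0 <= a -> a <= b -> b <= 2 -> lam `]a, b]%classic = b - a.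
Proof.
move=> a0 ab b2; rewrite /lam (_ : _ `&` _ = `]a, b]%classic) ?mu_itv//.
by apply/seteqP; split=> x /=; rewrite !in_itv/=; [case|split=> //]; lra.
Qed.

Section vector_measure.
Context (X : completeNormedModType R) (G : R -> X) (L : R).
Hypothesis L0 : 0 <= L.
Hypothesis GL : forall s t, 0 <= s <= 2 -> 0 <= t <= 2 ->
  `|G t - G s| <= L * `|t - s|.

Definition incr k i : X := G (i.+1%:R * dlen k) - G (i%:R * dlen k).

Lemma norm_incr k i : (i < 2 ^ k.+1)%N -> `|incr k i| <= L * dlen k.
Proof.
move=> ik; apply: le_trans (GL _ _) _.
- by rewrite node_ge0 node_le2// ltnW.
- by rewrite node_ge0 node_le2.
- by rewrite -mulrBl -natrB// subSnn mul1r gtr0_norm// dlen_gt0.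
Qed.

(** Lebesgue measure weighted by the derivative of the piecewise affine interpolation of [G] at the
    nodes of scale 2^-k; the [2 ^ k.+1] cells fill ]0, 2]. *)
Definition nu_ k A : X :=
  \sum_(i < 2 ^ k.+1) (mass k i A / dlen k) *: incr k i.

Lemma norm_nu_ k A : measurable A -> `|nu_ k A| <= L * lam A.
Proof.
move=> mA; rewrite (le_trans (ler_norm_sum _ _ _))//.
apply: (@le_trans _ _ (\sum_(i < 2 ^ k.+1) L * mass k (0 + i)%N A)).
  apply: ler_sum => i _; rewrite normrZ ger0_norm; last first.
    by rewrite divr_ge0 ?mass_ge0// ltW// dlen_gt0.
  have d0 := @dlen_gt0 R k.
  apply: (@le_trans _ _ (mass k i A / dlen k * (L * dlen k))).
    by rewrite ler_wpM2l ?norm_incr// divr_ge0 ?mass_ge0// ltW.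
  by rewrite [leLHS](_ : _ = L * mass k i A)//; field; rewrite gt_eqF.
by rewrite -mulr_sumr ler_wpM2l// sum_mass_le.
Qed.

Lemma nu_U k A B : measurable A -> measurable B -> A `&` B = set0 ->
  nu_ k (A `|` B) = nu_ k A + nu_ k B.
Proof.
move=> mA mB AB; rewrite /nu_ -big_split/=; apply: eq_bigr => i _.
by rewrite massU// mulrDl scalerDl.
Qed.

Lemma nu_D k A B : measurable A -> measurable B -> B `<=` A ->
  nu_ k (A `\` B) = nu_ k A - nu_ k B.
Proof.
move=> mA mB BA; apply/eqP; rewrite eq_sym subr_eq -nu_U//.
- by rewrite setUC setDUK.
- exact: measurableD.
- by rewrite setDE -setIA setICl setI0.
Qed.

(** A ray that starts at a node contains or misses each cell entirely, so the sum telescopes up to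
    [G 2]. *)
Lemma nu_node k m : (m <= 2 ^ k.+1)%N ->
  nu_ k `]m%:R * dlen k, +oo[%classic = G 2 - G (m%:R * dlen k).
Proof.
move=> mk; have d0 := @dlen_gt0 R k.
have massE (i : nat) : (i < 2 ^ k.+1)%N ->
    mass k i `]m%:R * dlen k, +oo[%classic = if (m <= i)%N then dlen k else 0.
  move=> ik; case: leqP => mi.
    rewrite /mass (_ : _ `&` _ = cell k i).
      by rewrite lam_itv ?node_ge0 ?node_le2//; lra.
    have : (m%:R : R) * dlen k <= i%:R * dlen k by rewrite ler_pM2r// ler_nat.
    by move=> h; apply/seteqP; split=> x; rewrite /cell /= !in_itv/= andbT;
      [case|split=> //]; lra.
  rewrite /mass (_ : _ `&` _ = set0) ?lam0//.
  have : (i.+1%:R : R) * dlen k <= m%:R * dlen k by rewrite ler_pM2r// ler_nat.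
  by move=> h; apply/seteqP; split=> x//; rewrite /cell /= !in_itv/= andbT; lra.
rewrite /nu_ -(big_mkord xpredT (fun i =>
  (mass k i `]m%:R * dlen k, +oo[%classic / dlen k) *: incr k i)).
rewrite (big_cat_nat (leq0n _) mk)//= big_nat big1 ?add0r; last first.
  by move=> i /andP[_ im]; rewrite massE ?(leq_trans im)// leqNgt im mul0r scale0r.
rewrite -[in RHS](dlen2 k) -(telescope_sumr (fun i => G (i%:R * dlen k)))//.
apply: eq_big_nat => i /andP[mi ik].
by rewrite massE// mi divff ?gt_eqF// scale1r.
Qed.

(** Moving [b] to the node below it changes [G b] by at most [L * dlen k] and enlarges the ray by
    part of one cell, where [nu_ k] is again at most [L * dlen k]; hence the factor 2. *)
Lemma nu_ray k b : 0 <= b <= 2 ->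
  `|nu_ k `]b, +oo[%classic - (G 2 - G b)| <= 2 * L * dlen k.
Proof.
move=> /andP[b0 b2]; have d0 := @dlen_gt0 R k.
have bd0 : 0 <= b / dlen k by rewrite divr_ge0// ltW.
pose m := Num.truncn (b / dlen k).
have /andP[] := truncn_itv bd0; rewrite -/m ler_pdivlMr// ltr_pdivrMr// => mb bm.
have mk : (m <= 2 ^ k.+1)%N.
  by rewrite -(ler_nat R) -(ler_pM2r d0) dlen2 (le_trans mb).
have mI : 0 <= (m%:R * dlen k : R) <= 2 by apply/andP; split; [exact: node_ge0|exact: node_le2].
have sub : `]b, +oo[%classic `<=` (`]m%:R * dlen k, +oo[%classic : set S).
  by move=> x /=; rewrite !in_itv/= !andbT; exact: le_lt_trans.
have bmd : b - m%:R * dlen k <= dlen k.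
  by move: bm; rewrite -natr1 mulrDl mul1r; lra.
have nuD := nu_D k (measurable_itvS _) (measurable_itvS _) sub.
rewrite (_ : nu_ k _ - _ = G b - G (m%:R * dlen k) -
   nu_ k (`]m%:R * dlen k, +oo[%classic `\` `]b, +oo[%classic)); last first.
  by rewrite nuD nu_node// !opprB [RHS]addrCA subrKA.
rewrite (le_trans (ler_normB _ _))// mulrDl mulrDl mul1r lerD//.
  by rewrite (le_trans (GL mI _)) ?b0// ler_wpM2l// ger0_norm// subr_ge0.
rewrite (le_trans (norm_nu_ _ _))//; first exact/measurableD/measurable_itvS/measurable_itvS.
rewrite ler_wpM2l// (le_trans _ bmd)//.
rewrite (_ : _ `\` _ = `]m%:R * dlen k, b]%classic) ?lam_itv ?node_ge0//.
apply/seteqP; split=> x /=; rewrite !in_itv/= !andbT.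
  by move=> [-> /negP]; rewrite -leNgt.
by move=> /andP[-> xb]; split => //; apply/negP; rewrite -leNgt.
Qed.

Lemma dlen_small (e : R) : 0 < e -> exists N, forall k, (N <= k)%N -> dlen k <= e.
Proof.
move=> e0; exists (Num.truncn e^-1) => k Nk.
rewrite /dlen -[leRHS]invrK lef_pV2 ?posrE ?exprn_gt0 ?invr_gt0//.
rewrite (le_trans (ltW (truncnS_gt _)))// -natrX ler_nat.
by rewrite (leq_trans _ (ltn_expl k (ltnSn 1))).
Qed.

(** Since [lam] only sees ]0, 2], the endpoint of a ray can be clamped to [0, 2], where [nu_ray]
    applies. *)
Lemma mass_clamp k i b : mass k i `]b, +oo[%classic =
  mass k i `]Num.max 0 (Num.min 2 b), +oo[%classic.
Proof.
rewrite /mass /lam; congr (fine (mu _)); rewrite !(setIAC _ (cell k i)).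
congr (_ `&` _); apply/seteqP; split=> x /=; rewrite !in_itv/= !andbT gt_max gt_min.
  by move=> [-> /andP[-> ->]]; rewrite orbT.
by move=> [/andP[_ /orP[|->]]]//; lra.
Qed.

(** Instance [c = 2 * L] of [dyadic_error_cvg0], both values being bounded by [L * lam A]. On a ray,
    both scales are compared with the same increment [G 2 - G b']. *)
Lemma nu_cauchy A e : measurable A -> 0 < e -> exists N, forall k k',
  (N <= k)%N -> (k <= k')%N -> `|nu_ k A - nu_ k' A| <= e.
Proof.
move=> mA e0; move: A mA e e0.
apply: (@dyadic_error_cvg0 R (2 * L) (fun k k' A => `|nu_ k A - nu_ k' A|)).
- by rewrite mulr_ge0.
- move=> k k' A _ mA; rewrite (le_trans (ler_normB _ _))// mulrDl mulrDl mul1r.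
  by rewrite lerD// norm_nu_.
- move=> k k' A B _ mA mB AB; rewrite !nu_U// opprD addrACA.
  exact: ler_normD.
- move=> k k' A B _ mA mB AB; rewrite !nu_D//.
  rewrite (_ : _ - _ - _ = nu_ k A - nu_ k' A - (nu_ k B - nu_ k' B)) ?ler_normB//.
  by rewrite !opprD !opprK addrACA.
- move=> b e e0; pose b' := Num.max 0 (Num.min 2 b).
  have b'I : 0 <= b' <= 2 by rewrite le_max lexx/= ge_max ge_min lexx/= ler0n.
  have e40 : 0 < e / (4 * (L + 1)) by rewrite divr_gt0// mulr_gt0// ltr_wpDl.
  have [N hN] := dlen_small e40; exists N => k k' Nk kk'.
  have nuE m : nu_ m `]b, +oo[%classic = nu_ m `]b', +oo[%classic.
    by apply: eq_bigr => i _; rewrite mass_clamp.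
  rewrite !nuE -(subrKA (G 2 - G b')).
  rewrite (le_trans (ler_normD _ _))// (@le_trans _ _ (2 * L * dlen k + 2 * L * dlen k'))//.
    by rewrite lerD// ?nu_ray// -normrN opprB nu_ray.
  have h1 := hN _ Nk; have h2 := hN _ (leq_trans Nk kk').
  apply: (@le_trans _ _ (2 * (L + 1) * (e / (4 * (L + 1))) + 2 * (L + 1) * (e / (4 * (L + 1))))).
    by rewrite lerD// ler_pM// ?(ltW (dlen_gt0 _))// ?mulr_ge0// ler_wpM2l// lerDl.
  have L1 : L + 1 != 0 by rewrite gt_eqF// ltr_wpDl.
  by rewrite [leLHS](_ : _ = e)//; field.
Qed.

End vector_measure.
End dyadic_measure.
Arguments cell {R}.
Arguments cells {R}.

(** * The vector measure of a Lipschitz path *)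

Section limit_measure.
Context (R : realType).
Notation mu := (@completed_lebesgue_measure R).
Notation S := (caratheodory_type (wlength (@idfun R))^*%mu).
Implicit Types (A B : set S) (a b : R).
Context (X : completeNormedModType R) (G : R -> X) (L : R).
Hypothesis L0 : 0 <= L.
Hypothesis GL : forall s t, 0 <= s <= 2 -> 0 <= t <= 2 ->
  `|G t - G s| <= L * `|t - s|.

(** The vector-valued Stieltjes measure of [G] on ]0, 2], as a setwise limit; by [cvg_nu] the limit
    exists on measurable sets. *)
Definition nu A : X := lim (nu_ G k A @[k --> \oo]).

Lemma cvg_nu A : measurable A -> nu_ G k A @[k --> \oo] --> nu A.
Proof.
move=> mA; apply: cauchy_cvg; apply: cauchy_exP => e e0.
have e20 : 0 < e / 2 by rewrite divr_gt0.
have [N hN] := nu_cauchy L0 GL mA e20.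
exists (nu_ G N A); exists N => // k /= Nk; rewrite -ball_normE/=.
rewrite (le_lt_trans (hN _ _ (leqnn N) Nk))//.
by rewrite gtr_pMr// invf_lt1// ltr1n.
Qed.

Lemma norm_nu A : measurable A -> `|nu A| <= L * lam A.
Proof.
move=> mA; apply: (closed_cvg (fun x => x <= L * lam A) _ _ _
  (cvg_norm (cvg_nu mA))); first exact: closed_le.
by apply: nearW => k; exact: norm_nu_.
Qed.

Lemma nuU A B : measurable A -> measurable B -> A `&` B = set0 ->
  nu (A `|` B) = nu A + nu B.
Proof.
move=> mA mB AB; apply: (cvg_lim (@norm_hausdorff _ X)).
rewrite (_ : (fun k => _) = (fun k => nu_ G k A + nu_ G k B)).
  by apply: cvgD; exact: cvg_nu.
by apply/funext => k; rewrite nu_U.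
Qed.

Lemma nuD A B : measurable A -> measurable B -> B `<=` A ->
  nu (A `\` B) = nu A - nu B.
Proof.
move=> mA mB BA; apply/eqP; rewrite eq_sym subr_eq -nuU//.
- by rewrite setUC setDUK.
- exact: measurableD.
- by rewrite setDE -setIA setICl setI0.
Qed.

Lemma nu_rayE b : 0 <= b <= 2 -> nu `]b, +oo[%classic = G 2 - G b.
Proof.
move=> b02; apply: (cvg_lim (@norm_hausdorff _ X)).
apply/cvgrPdist_le => e e0.
have e20 : 0 < e / (2 * (L + 1)) by rewrite divr_gt0// mulr_gt0// ltr_wpDl.
have [N hN] := dlen_small e20; exists N => // k /= Nk.
rewrite distrC (le_trans (nu_ray L0 GL k b02))//.
apply: (@le_trans _ _ (2 * (L + 1) * (e / (2 * (L + 1))))).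
  by rewrite ler_pM ?mulr_ge0 ?(ltW (dlen_gt0 _)) ?hN// ler_wpM2l// lerDl.
have L1 : L + 1 != 0 by rewrite gt_eqF// ltr_wpDl.
by rewrite [leLHS](_ : _ = e)//; field.
Qed.

Lemma nu_itv a b : 0 <= a -> a <= b -> b <= 2 ->
  nu `]a, b]%classic = G b - G a.
Proof.
move=> a0 ab b2; rewrite (_ : `]a, b]%classic = `]a, +oo[ `\` `]b, +oo[).
  rewrite nuD ?nu_rayE ?a0 ?b2 ?(le_trans ab)// ?(le_trans a0)//.
  - by rewrite opprB addrC subrKA.
  - exact: measurable_itvS.
  - exact: measurable_itvS.
  - by move=> x /=; rewrite !in_itv/= !andbT; exact: le_lt_trans.
apply/seteqP; split=> x /=; rewrite !in_itv/= !andbT.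
  by move=> /andP[-> xb]; split => //; apply/negP; rewrite -leNgt.
by move=> [-> /negP]; rewrite -leNgt.
Qed.

(** Finite additivity and the bound [L * lam] suffice: the union minus its first [n] sets has [lam]
    tending to 0. *)
Lemma nu_vector_measure : vector_measure nu.
Proof.
move=> F mF tF; set U := \bigcup_i F i.
have mU : measurable U by exact: bigcupT_measurable.
pose V n := \bigcup_(i < n) F i.
have mV n : measurable (V n) by exact: bigcup_measurable.
have VU n : V n `<=` U by apply: bigcup_sub => i _; exact: bigcup_sup.
have VS n : V n.+1 = V n `|` F n by rewrite /V !bigcup_mkord big_ord_recr.
have VF n : V n `&` F n = set0.
  rewrite -subset0 => x [[i/= ilt Fi] Fn].
  have : (i < n)%N := ilt; suff -> : i = n by rewrite ltnn.
  by apply: (tF i n) => //; exists x.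
have nuV n : nu (V n) = series (nu \o F) n.
  elim: n => [|n IH].
    rewrite /V bigcup_mkord big_ord0 /series/= big_geq//.
    by apply/eqP; rewrite -normr_le0 (le_trans (norm_nu _))// lam0 ?mulr0.
  by rewrite VS nuU// IH -seriesSr.
have lV : lam \o V @ \oo --> lam U.
  apply: fine_cvg; rewrite fineK ?lam_fin//.
  have -> : U `&` `]0, 2] = \bigcup_n (V n `&` `]0, 2]).
    rewrite -setI_bigcupl; congr (_ `&` _); apply/seteqP; split.
      by move=> x [i _ Fi]; exists i.+1 => //; exists i => /=.
    by apply: bigcup_sub.
  apply: nondecreasing_cvg_mu.
  - by move=> i; apply: measurableI => //; exact: measurable_itvS.
  - by apply: bigcupT_measurable => i; apply: measurableI => //;
      exact: measurable_itvS.
  - move=> i j ij; apply/subsetPset; apply: setSI; apply: bigcup_sub => m /= mi.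
    by apply: bigcup_sup => /=; exact: leq_trans ij.
apply/cvgrPdist_le => e e0.
have e20 : 0 < e / (L + 1) by rewrite divr_gt0// ltr_wpDl.
move/cvgrPdist_le/(_ _ e20): lV => [N _ hN]; exists N => // n /hN /=.
rewrite -lamD// ger0_norm ?lam_ge0// => h.
rewrite -nuV -nuD// (le_trans (norm_nu _))//; first exact: measurableD.
apply: (@le_trans _ _ ((L + 1) * (e / (L + 1)))).
  by rewrite ler_pM ?lam_ge0// lerDl.
by rewrite mulrC divfK// gt_eqF// ltr_wpDl.
Qed.

Lemma nu_variation : (vector_variation nu < +oo)%E.
Proof.
apply: (@le_lt_trans _ _ (L * lam setT)%:E); last exact: ltry.
apply: ge_ereal_sup => _ [k [F [mF tF UF ->]]]; rewrite lee_fin.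
apply: (@le_trans _ _ (\sum_(i < k) L * lam (F i))).
  by apply: ler_sum => i _; exact: norm_nu.
rewrite -mulr_sumr ler_wpM2l// -lee_fin -sumEFin.
rewrite (eq_bigr (fun i => mu (F i `&` `]0, 2]%classic))); last first.
  by move=> i _; rewrite fineK// lam_fin.
rewrite -measure_bigsetU_ord//.
- rewrite /lam fineK ?lam_fin//; apply: le_measure; rewrite ?inE.
  + by apply: bigsetU_measurable => i _; apply: measurableI => //; exact: measurable_itvS.
  + by apply: measurableI => //; exact: measurable_itvS.
  + by rewrite setTI -big_distrl/=; exact: subIsetr.
- by move=> i; apply: measurableI => //; exact: measurable_itvS.
- exact: trivIset_setIr.
Qed.

Lemma nu_ac : absolutely_continuous mu nu.
Proof.
move=> A mA A0; apply/eqP; rewrite -normr_le0 (le_trans (norm_nu mA))//.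
by rewrite lam0// mulr0.
Qed.

End limit_measure.

(** * Averages over sliding windows *)

Section sliding_average.
Context (R : realType).
Notation mu := (@completed_lebesgue_measure R).
Notation S := (caratheodory_type (wlength (@idfun R))^*%mu).
Implicit Types (A B : set S) (a b : R).

(** After exchanging the sums, each offset [j] contributes a sum over a shifted range, at most [B],
    and [q] of these are averaged. *)
Lemma sum_window (r : nat -> R) (M q : nat) (B : R) : (0 < q)%N ->
  (forall j, \sum_(i < M) r (j + i)%N <= B) ->
  \sum_(i < M) (\sum_(j < q) r (i + j)%N) / q%:R <= B.
Proof.
move=> q0 rB; rewrite -mulr_suml exchange_big/= ler_pdivrMr ?ltr0n//.
rewrite -[q in leRHS]card_ord mulr_natr -sumr_const; apply: ler_sum => j _.
by apply: le_trans (rB j); apply: ler_sum => i _; rewrite addnC.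
Qed.

(* Compares, cell by cell at scale 2^-k', the mean mass of A over a window of
   length 2^-k with the mass of A in the first cell of the window. *)
Definition slide k k' A : R := \sum_(i < 2 ^ k')
  `|(\sum_(j < 2 ^ (k' - k)) mass k' (i + j)%N A) / (2 ^ (k' - k))%:R
    - mass k' i A|.

Lemma slide_le k k' A : measurable A -> slide k k' A <= 2 * lam A.
Proof.
move=> mA; rewrite mulrDl mul1r; apply: (@le_trans _ _ (\sum_(i < 2 ^ k')
  ((\sum_(j < 2 ^ (k' - k)) mass k' (i + j)%N A) / (2 ^ (k' - k))%:R
    + mass k' (0 + i)%N A))).
  apply: ler_sum => i _; rewrite (le_trans (ler_normB _ _))// !ger0_norm//.
  - exact: mass_ge0.
  - by rewrite divr_ge0// sumr_ge0// => j _; exact: mass_ge0.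
rewrite big_split/= lerD//; last exact: sum_mass_le.
by apply: (@sum_window (mass k' ^~ A)); [rewrite expn_gt0|move=> j; exact: sum_mass_le].
Qed.

Lemma slideU k k' A B : measurable A -> measurable B -> A `&` B = set0 ->
  slide k k' (A `|` B) <= slide k k' A + slide k k' B.
Proof.
move=> mA mB AB; rewrite -big_split/=; apply: ler_sum => i _.
rewrite massU// (eq_bigr _ (fun _ _ => massU _ _ mA mB AB)) big_split/=.
by rewrite mulrDl opprD addrACA ler_normD.
Qed.

Lemma slideD k k' A B : measurable A -> measurable B -> B `<=` A ->
  slide k k' (A `\` B) <= slide k k' A + slide k k' B.
Proof.
move=> mA mB AB; rewrite -big_split/=; apply: ler_sum => i _.
rewrite massD// (eq_bigr _ (fun _ _ => massD _ _ mA mB AB)) sumrB.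
set x := \sum_(_ < _) mass _ _ A; set y := \sum_(_ < _) mass _ _ B.
rewrite (_ : _ - _ = x / (2 ^ (k' - k))%:R - mass k' i A -
  (y / (2 ^ (k' - k))%:R - mass k' i B)); first exact: ler_normB.
by rewrite mulrBl; lra.
Qed.

Lemma mass_le_dlen k i A : measurable A -> mass k i A <= dlen k.
Proof.
move=> mA; have h : i%:R * dlen k <= i.+1%:R * dlen k :> R.
  by rewrite ler_pM2r ?dlen_gt0// ler_nat.
apply: (@le_trans _ _ (fine (mu (cell k i)))); last first.
  by rewrite mu_itv//= -mulrBl -natrB// subSnn mul1r.
have mc : measurable (A `&` cell k i) by exact/measurableI/measurable_cell.
rewrite fine_le ?lam_fin//; first by rewrite mu_itv.
apply: le_measure; rewrite ?inE//.
- by apply: measurableI => //; exact: measurable_itvS.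
- exact: measurable_cell.
- by apply: subset_trans (@subIsetl _ _ _) _; exact: subIsetr.
Qed.

(** For [i < i'], a ray that meets cell [i] starts to the left of cell [i'] and covers it; the bound
    on [i'] keeps that cell inside ]0, 2], so that [lam] counts all of it. *)
Lemma le_mass_ray k b i i' : (i <= i')%N -> (i' < 2 ^ k.+1)%N ->
  mass k i `]b, +oo[%classic <= mass k i' `]b, +oo[%classic.
Proof.
rewrite leq_eqVlt => /predU1P[->//|ii'] i'k; have d0 := @dlen_gt0 R k.
have [bi|ib] := leP b (i'%:R * dlen k).
  rewrite (le_trans (mass_le_dlen _ _ (measurable_itvS _)))//.
  rewrite /mass (_ : _ `&` _ = cell k i'); last first.
    by apply/seteqP; split=> x; rewrite /cell /= !in_itv/= andbT; [case|split=> //]; lra.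
  rewrite lam_itv ?node_ge0 ?node_le2//.
    by rewrite -mulrBl -natrB// subSnn mul1r.
  by rewrite ler_pM2r// ler_nat.
rewrite {1}/mass (_ : _ `&` _ = set0) ?lam0 ?mass_ge0//.
have : (i.+1%:R : R) * dlen k <= i'%:R * dlen k by rewrite ler_pM2r// ler_nat.
by move=> h; apply/seteqP; split=> x//; rewrite /cell /= !in_itv/= andbT; lra.
Qed.

(** On a ray the masses increase with the cell, so the absolute values disappear. For each offset
    [j <= q] the difference of the shifted and unshifted sums is then at most [j] cells of length
    2^-k', and [q] such cells have length 2^-k. *)
Lemma slide_ray k k' b : (k <= k')%N ->
  slide k k' `]b, +oo[%classic <= dlen k.
Proof.
move=> kk'; set A : set S := `]b, +oo[%classic; set q := (2 ^ (k' - k))%N.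
have mA : measurable A by exact: measurable_itvS.
have q0 : (0 < q)%N by rewrite expn_gt0.
have qk' : (q <= 2 ^ k')%N by rewrite leq_exp2l// leq_subr.
have jump j : (j <= q)%N ->
    \sum_(i < 2 ^ k') (mass k' (i + j)%N A - mass k' i A) <= dlen k.
  move=> jq; rewrite sumrB lerBlDr.
  apply: (@le_trans _ _ (\sum_(0 <= i < 2 ^ k' + j) mass k' i A)).
    rewrite (@big_cat_nat _ _ _ j)//= ?leq_addl//.
    rewrite -[X in (X <= _)%R]add0r lerD//.
      by rewrite sumr_ge0// => i _; exact: mass_ge0.
    rewrite [leRHS](_ : _ = \sum_(i < 2 ^ k') mass k' (i + j)%N A)//.
    by rewrite -{1}[j]add0n big_addn addnK big_mkord.
  rewrite (@big_cat_nat _ _ _ (2 ^ k'))//= ?leq_addr// big_mkord addrC lerD2r.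
  rewrite (dlenE _ _ kk') -/q.
  apply: (@le_trans _ _ (\sum_(2 ^ k' <= i < 2 ^ k' + j) dlen k')).
    by apply: ler_sum => i _; exact: mass_le_dlen.
  rewrite sumr_const_nat addKn -[leLHS]mulr_natl ler_pM2r ?dlen_gt0//.
  by rewrite ler_nat.
rewrite /slide -/q; apply: (@le_trans _ _ (\sum_(i < 2 ^ k')
    (\sum_(j < q) (mass k' (i + j)%N A - mass k' i A)) / q%:R)).
  apply: ler_sum => i _; rewrite sumrB sumr_const card_ord mulrBl.
  rewrite -[X in _ <= _ - X / _]mulr_natr mulfK ?pnatr_eq0 -?lt0n//.
  rewrite ger0_norm// subr_ge0 ler_pdivlMr ?ltr0n// mulr_natr.
  rewrite -[X in _ *+ X]card_ord -sumr_const; apply: ler_sum => j _.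
  apply: le_mass_ray; first exact: leq_addr.
  rewrite expnS mul2n -addnn -addSn leq_add// (leq_trans (ltnW (ltn_ord j)))//.
rewrite -mulr_suml exchange_big/= ler_pdivrMr ?ltr0n//.
rewrite mulr_natr -[X in _ *+ X]card_ord -sumr_const; apply: ler_sum => j _.
by apply: jump; rewrite ltnW.
Qed.

(** Instance [c = 2] of [dyadic_error_cvg0]. In L^1 terms, means of an indicator over windows of
    length 2^-k approach its means over the finer cells, uniformly in the finer scale. *)
Lemma slide_cvg0 A e : measurable A -> 0 < e -> exists N, forall k k',
  (N <= k)%N -> (k <= k')%N -> slide k k' A <= e.
Proof.
move=> mA e0; move: A mA e e0; apply: (@dyadic_error_cvg0 R 2 slide) => //.
- by move=> *; exact: slide_le.
- by move=> *; exact: slideU.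
- by move=> *; exact: slideD.
move=> b e e0; have [N hN] := dlen_small e0.
by exists N => k k' Nk kk'; rewrite (le_trans (slide_ray _ _)) ?hN.
Qed.

End sliding_average.

(** * Bochner integrals of simple functions *)

Section ae_limit.
Context d (T : measurableType d) (R : realType) (mu : {measure set T -> \bar R}).
Hypothesis cmu : measure_is_complete mu.

Lemma ae_eq_measurable (D : set T) (f g : T -> R) :
  {ae mu, forall x, D x -> f x = g x} ->
  measurable_fun D f -> measurable_fun D g.
Proof.
move=> fg mf; apply/measurable_EFinP.
apply: (@ae_measurable_fun _ _ _ mu cmu D (EFin \o f)); last exact/measurable_EFinP.
by apply: filterS fg => x h /h /= ->.
Qed.

(** Multiplying by the indicator of the complement of the exceptional set makes the sequence
    converge everywhere on [D]; completeness then undoes the change. *)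
Lemma ae_cvg_measurable (D : set T) (f_ : nat -> T -> R) (f : T -> R) :
  measurable D -> (forall k, measurable_fun D (f_ k)) ->
  {ae mu, forall x, D x -> f_ k x @[k --> \oo] --> f x} ->
  measurable_fun D f.
Proof.
move=> mD mf [N [mN N0 fN]].
apply: (@ae_eq_measurable _ (fun x => f x * \1_(~` N) x)).
  exists N; split=> // x /= /not_implyP[Dx].
  by apply: contra_notP => Nx; rewrite indicE mem_set// mulr1.
apply: (@measurable_fun_cvg _ _ _ D (fun k x => f_ k x * \1_(~` N) x)).
  move=> k; apply: measurable_funM => //.
  by apply: measurable_indic; exact: measurableC.
move=> x Dx; rewrite /= indicE.
have [Nx|Nx] := pselect (N x).
  rewrite memNset; last by move/(_ Nx).
  rewrite mulr0; under eq_fun do rewrite mulr0; exact: cvg_cst.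
rewrite mem_set// mulr1; under eq_fun do rewrite mulr1.
by apply: contrapT => h; apply/Nx/fN => /= /(_ Dx).
Qed.

End ae_limit.

Section simple_functions.
Context d (S : measurableType d) (R : realType).
Context (mu : {measure set S -> \bar R}).

(** A preimage under [phi \o s] is a finite union of fibers of [s], for an arbitrary function
    [phi]. *)
Lemma simple_function_measurable (E : normedModType R) (s : S -> E) (phi : E -> R) :
  simple_function s -> measurable_fun setT (phi \o s).
Proof.
move=> [fs ms] _ B mB; rewrite setTI.
rewrite (_ : _ @^-1` B = \bigcup_(v in range s `&` phi @^-1` B) s @^-1` [set v]).
  by apply: fin_bigcup_measurable => // ; exact: finite_setIl.
apply/seteqP; split=> [x Bx|x [v [_ Bv] sx]].
  by exists (s x) => //; split=> //; exists x.
by move: Bv; rewrite /= -sx.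
Qed.

Lemma simple_function_pair (E F : normedModType R) (s : S -> E) (t : S -> F) :
  simple_function s -> simple_function t ->
  simple_function (fun x => (s x, t x)).
Proof.
move=> [fs ms] [ft mt]; split.
  apply: (sub_finite_set _ (finite_setX fs ft)) => _ [x _ <-].
  by split; exists x.
move=> [v w]; rewrite (_ : _ @^-1` _ = s @^-1` [set v] `&` t @^-1` [set w]).
  exact: measurableI.
by apply/seteqP; split=> x /= [-> ->].
Qed.

Context (E : normedModType R).
Implicit Types s t : S -> E.

Lemma dist_simple_measurable s t : simple_function s -> simple_function t ->
  measurable_fun setT (fun x => `|s x - t x|).
Proof.
move=> hs ht; exact: (simple_function_measurable
  (fun vw : E * E => `|vw.1 - vw.2|) (simple_function_pair hs ht)).
Qed.

Lemma dist_strongly_measurable (f s : S -> E) : measure_is_complete mu ->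
  strongly_measurable mu setT f -> simple_function s ->
  measurable_fun setT (fun x => `|f x - s x|).
Proof.
move=> cmu [s_ [ss_ sf]] ss.
apply: (ae_cvg_measurable cmu measurableT
  (fun k => dist_simple_measurable (ss_ k) ss)).
apply: filterS sf => x /(_ I) sfx _.
by apply: cvg_norm; apply: cvgB => //; exact: cvg_cst.
Qed.

Lemma simple_range s : simple_function s ->
  exists2 r : seq E, uniq r & range s = [set` r].
Proof.
move=> [/finite_seqP[r rE] _]; exists (undup r); first exact: undup_uniq.
by rewrite rE; apply/seteqP; split=> x /=; rewrite mem_undup.
Qed.

Lemma simple_integralE (r : seq E) s J : uniq r -> range s = [set` r] ->
  simple_integral mu J s =
  \sum_(v <- r) fine (mu (J `&` s @^-1` [set v])) *: v.
Proof. by move=> ur rE; rewrite /simple_integral rE -fsbig_seq. Qed.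

Lemma fiber_partition (r : seq E) s J : range s = [set` r] ->
  J = \big[setU/set0]_(v <- r) (J `&` s @^-1` [set v]).
Proof.
move=> rE; rewrite -bigcup_seq; apply/seteqP; split=> [x Jx|x [v _ []]//].
by exists (s x) => //; rewrite -rE; exists x.
Qed.

Lemma fiber_trivIset D s J : trivIset D (fun v => J `&` s @^-1` [set v]).
Proof. by move=> v w _ _ [x [[_ /= <-] [_ /= <-]]]. Qed.

Lemma measure_fiber (r : seq E) s J : uniq r -> range s = [set` r] ->
  simple_function s -> measurable J ->
  mu J = (\sum_(v <- r) mu (J `&` s @^-1` [set v]))%E.
Proof.
move=> ur rE [_ ms] mJ; rewrite {1}(fiber_partition J rE) -bigcup_seq.
rewrite measure_fin_bigcup//.
- by rewrite -fsbig_seq.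
- exact: fiber_trivIset.
- by move=> v _; exact: measurableI.
Qed.

Lemma integral_fiber (r : seq E) s J (g : S -> \bar R) : uniq r ->
  range s = [set` r] -> simple_function s -> measurable J ->
  measurable_fun J g -> (forall x, J x -> 0 <= g x)%E ->
  (\int[mu]_(x in J) g x =
   \sum_(v <- r) \int[mu]_(x in J `&` s @^-1` [set v]) g x)%E.
Proof.
move=> ur rE [_ ms] mJ mg g0; rewrite {1}(fiber_partition J rE).
apply: ge0_integral_bigsetU => //.
- by move=> v; exact: measurableI.
- exact: fiber_trivIset.
- by rewrite -fiber_partition.
- by move=> x; rewrite -fiber_partition//; exact: g0.
Qed.

(** Both functions are constant on the pieces [F v w] of the common refinement of their fibers, and
    both sides become finite sums over these pieces. Finiteness of [mu J] makes each [fine]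
    faithful. *)
Lemma simple_integralB_le s t J : simple_function s -> simple_function t ->
  measurable J -> (mu J < +oo)%E ->
  ((`|simple_integral mu J s - simple_integral mu J t|)%:E <=
   \int[mu]_(x in J) (`|s x - t x|)%:E)%E.
Proof.
move=> ss st mJ Joo.
have [r1 u1 e1] := simple_range ss; have [r2 u2 e2] := simple_range st.
pose F v w := J `&` s @^-1` [set v] `&` t @^-1` [set w].
have ms v : measurable (J `&` s @^-1` [set v]) by apply: measurableI => //; case: ss.
have mt v : measurable (J `&` t @^-1` [set v]) by apply: measurableI => //; case: st.
have mF v w : measurable (F v w) by apply: measurableI => //; case: st.
have finS (A : set S) : measurable A -> A `<=` J -> mu A \is a fin_num.
  move=> mA AJ; rewrite ge0_fin_numE// (le_lt_trans _ Joo)//.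
  by rewrite le_measure ?inE.
have FJ v w : F v w `<=` J by move=> x [[]].
have E1 : simple_integral mu J s =
    \sum_(v <- r1) \sum_(w <- r2) fine (mu (F v w)) *: v.
  rewrite (simple_integralE _ u1 e1); apply: eq_bigr => v _.
  rewrite (measure_fiber u2 e2 st (ms v)) -sum_fine ?scaler_suml//.
  by move=> w _; apply: finS; [exact: mF|exact: FJ].
have E2 : simple_integral mu J t =
    \sum_(v <- r1) \sum_(w <- r2) fine (mu (F v w)) *: w.
  rewrite (simple_integralE _ u2 e2) exchange_big/=; apply: eq_bigr => w _.
  rewrite (measure_fiber u1 e1 ss (mt w)) -sum_fine ?scaler_suml//.
    by apply: eq_bigr => v _; rewrite /F setIAC.
  by move=> v _; rewrite setIAC; apply: finS; [exact: mF|exact: FJ].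
rewrite E1 E2 -sumrB; under eq_bigr do rewrite -sumrB.
have mg : measurable_fun setT (fun x => (`|s x - t x|)%:E).
  by apply/measurable_EFinP; exact: dist_simple_measurable.
rewrite (integral_fiber u1 e1 ss mJ)//; last exact: measurable_funTS.
apply: (@le_trans _ _ (\sum_(v <- r1) \sum_(w <- r2)
    (`|fine (mu (F v w)) *: v - fine (mu (F v w)) *: w|)%:E)%E).
  rewrite (eq_bigr (fun v => (\sum_(w <- r2)
    `|fine (mu (F v w)) *: v - fine (mu (F v w)) *: w|)%:E)); last first.
    by move=> v _; rewrite sumEFin.
  rewrite sumEFin lee_fin (le_trans (ler_norm_sum _ _ _))//.
  by apply: ler_sum => v _; exact: ler_norm_sum.
apply: lee_sum => v _.
rewrite (integral_fiber u2 e2 st (ms v))//; last exact: measurable_funTS.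
apply: lee_sum => w _; rewrite -/(F v w).
rewrite (eq_integral (cst (`|v - w|)%:E)); last first.
  by move=> x /set_mem[[_ /= ->] /= ->].
rewrite integral_cst// -scalerBr normrZ ger0_norm ?fine_ge0// EFinM muleC.
by rewrite fineK// finS//; exact: FJ.
Qed.

(** The inequality for simple functions is applied to the approximants [s_ k] of [f]; the extra
    term, the integral of [|f - s_ k|], vanishes in the limit. *)
Lemma bochner_integral_dist_le (f s : S -> E) J e : measure_is_complete mu ->
  strongly_measurable mu setT f -> simple_function s ->
  measurable J -> (mu J < +oo)%E -> is_bochner_integral mu J f e ->
  ((`|e - simple_integral mu J s|)%:E <= \int[mu]_(x in J) (`|f x - s x|)%:E)%E.
Proof.
move=> cmu mf ss mJ Joo [s_ [is_ sf If Ie]].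
have mfs t : simple_function t ->
    measurable_fun J (fun x => (`|f x - t x|)%:E).
  by move=> st; apply/measurable_EFinP/measurable_funTS/dist_strongly_measurable.
set a := (\int[mu]_(x in J) _)%E.
have ub k : ((`|simple_integral mu J (s_ k) - simple_integral mu J s|)%:E <=
    \int[mu]_(x in J) (`|f x - s_ k x|)%:E + a)%E.
  rewrite (le_trans (simple_integralB_le _ _ _ _))//; first exact: (is_ k).1.
  rewrite -ge0_integralD//; [|exact: (mfs _ (is_ k).1)|exact: mfs].
  apply: ge0_le_integral => //.
  - by apply/measurable_EFinP/measurable_funTS/dist_simple_measurable => //; exact: (is_ k).1.
  - by apply: emeasurable_funD; [exact: (mfs _ (is_ k).1)|exact: mfs].
  - move=> x _; rewrite -EFinD lee_fin -(subrKA (f x)) addrC.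
    by rewrite (le_trans (ler_normD _ _))// addrC distrC.
have lhs : ((`|simple_integral mu J (s_ k) - simple_integral mu J s|)%:E
    @[k --> \oo] --> (`|e - simple_integral mu J s|)%:E)%E.
  by apply: cvg_EFin; [exact: nearW|apply: cvg_norm; apply: cvgB => //; exact: cvg_cst].
have [aoo|afin] := eqVneq a +oo%E; first by rewrite aoo leey.
have a_fin : a \is a fin_num.
  by rewrite ge0_fin_numE ?ltey//; apply: integral_ge0.
have rhs : ((\int[mu]_(x in J) (`|f x - s_ k x|)%:E + a) @[k --> \oo] --> 0 + a)%E.
  by apply: cvgeD => //; exact: cvg_cst.
rewrite -[leRHS]add0e; apply: (lee_cvg_to lhs rhs); exact: nearW.
Qed.

End simple_functions.

(** * Lipschitz paths in a space with the Radon-Nikodym property *)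

Section radon_nikodym_dyadic.
Context (R : realType).
Notation mu := (@completed_lebesgue_measure R).
Notation S := (caratheodory_type (wlength (@idfun R))^*%mu).
Context (X : completeNormedModType R).

Lemma integral_cells k (a q : nat) (g : S -> \bar R) :
  measurable_fun setT g -> (forall x, 0 <= g x)%E ->
  (\sum_(i < q) \int[mu]_(x in cell k (a + i)) g x =
   \int[mu]_(x in cells k a q) g x)%E.
Proof.
move=> mg g0; elim: q => [|q IH].
  by rewrite big_ord0 cells_nil integral_set0.
rewrite big_ord_recr/= IH cells_cat ge0_integral_setU//.
- exact: measurable_cells.
- exact: measurable_cell.
- exact: measurable_funTS.
- by apply/disj_setPS; rewrite cells_disj.
Qed.

(** The bound on [a + q] places the window inside ]0, 2], where [lam] agrees with Lebesgue
    measure. *)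
Lemma simple_integral_cells (r : seq X) (s : S -> X) k (a q : nat) :
  uniq r -> range s = [set` r] -> simple_function s ->
  (a + q <= 2 ^ k.+1)%N ->
  simple_integral mu (cells k a q) s =
  \sum_(v <- r) (\sum_(i < q) mass k (a + i) (s @^-1` [set v])) *: v.
Proof.
move=> ur rE [_ ms] aq; rewrite (simple_integralE _ _ ur rE).
apply: eq_bigr => v _; rewrite sum_mass// setIC /lam.
congr (fine (mu _) *: _); rewrite -setIA; congr (_ `&` _).
have h : ((a + q)%N%:R : R) * dlen k <= 2 by rewrite node_le2.
have h0 : 0 <= (a%:R : R) * dlen k by rewrite node_ge0.
by apply/seteqP; split=> x; rewrite /cells/= !in_itv/=; [move=> h1; split=> //|case]; lra.
Qed.

(** Increments of [G] are integrals of the density [f]. Replacing [f] by a simple [s] costs little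
    in the mean over base points, and for [s] the two quotients differ by window and cell masses of
    finitely many fibers, which [slide_cvg0] controls. *)
Theorem radon_nikodym_dyadic_cauchy (G : R -> X) (L : R) :
  radon_nikodym_property X -> 0 <= L ->
  (forall s t, 0 <= s <= 2 -> 0 <= t <= 2 -> `|G t - G s| <= L * `|t - s|) ->
  forall e, 0 < e -> exists N, forall k k', (N <= k)%N -> (k <= k')%N ->
    exists t, [/\ 0 <= t, t <= 1 &
      `|(dlen k)^-1 *: (G (t + dlen k) - G t) -
        (dlen k')^-1 *: (G (t + dlen k') - G t)| <= e].
Proof.
move=> rnp L0 GL e e0.
have [f [[mf _] If]] := rnp _ S mu (nu G) (sigma_finiteT mu)
  (@completed_lebesgue_measure_is_complete R) (nu_vector_measure L0 GL)
  (nu_variation L0 GL) (nu_ac L0 GL).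
have cmu := @completed_lebesgue_measure_is_complete R.
have e40 : 0 < e / 4 by rewrite divr_gt0.
(* The approximants in the Bochner integral over the whole line come with L^1 convergence to [f]. *)
have [s ss fs] : exists2 s, simple_function s &
    (\int[mu]_x (`|f x - s x|)%:E < (e / 4)%:E)%E.
  have [s_ [is_ _ + _]] := If _ measurableT.
  move/fine_cvgP => [fins /cvgrPdist_lt/(_ _ e40)] h.
  have [k [/= fk hk]] := @filter_ex _ \oo _ _ (filterI fins h).
  exists (s_ k); first exact: (is_ k).1.
  rewrite -(fineK fk) lte_fin; apply: le_lt_trans hk.
  by rewrite sub0r normrN ler_norm.
have mg : measurable_fun setT (fun x => (`|f x - s x|)%:E).
  by apply/measurable_EFinP; exact: (dist_strongly_measurable cmu mf ss).
have [r ur rE] := simple_range ss.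
pose M := \sum_(v <- r) `|v|.
have M0 : 0 <= M by apply: sumr_ge0.
have [N hN] : exists N, forall k k', (N <= k)%N -> (k <= k')%N ->
    forall v, v \in r -> slide k k' (s @^-1` [set v]) <= e / (4 * (M + 1)).
  have d0 : 0 < e / (4 * (M + 1)) by rewrite divr_gt0// mulr_gt0// ltr_wpDl.
  have ms v : measurable (s @^-1` [set v]) by case: ss.
  elim: (r) => [|v l [N hN]]; first by exists 0.
  have [N' hN'] := slide_cvg0 (ms v) d0.
  exists (maxn N N') => k k'; rewrite geq_max => /andP[k1 k2] kk' w.
  by rewrite inE => /predU1P[->|wl]; [exact: hN'|exact: hN].
exists N => k k' Nk kk'; set q := (2 ^ (k' - k))%N.
have q0 : (0 < q)%N by rewrite expn_gt0.
have qk' : (q <= 2 ^ k')%N by rewrite leq_exp2l// leq_subr.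
have h'0 := @dlen_gt0 R k'; have h0 := @dlen_gt0 R k.
have hq : dlen k = q%:R * dlen k' :> R by rewrite (dlenE _ _ kk').
have hE : dlen k' * (dlen k)^-1 = q%:R^-1 :> R.
  by rewrite hq invfM mulrCA mulfV ?gt_eqF// mulr1.
have aux (W : zmodType) (x y z w : W) : x - z = x - y - (z - w) + (y - w).
  by rewrite opprB addrAC !subrKA.
pose rho c := fine (\int[mu]_(x in cell k' c) (`|f x - s x|)%:E).
have rho_fin (A : set S) : measurable A ->
    (\int[mu]_(x in A) (`|f x - s x|)%:E \is a fin_num)%E.
  move=> mA; rewrite ge0_fin_numE ?integral_ge0//.
  rewrite (@le_lt_trans _ _ (\int[mu]_x (`|f x - s x|)%:E)%E)//.
    by apply: ge0_subset_integral.
  by rewrite (lt_trans fs)// ltry.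
have rho0 c : 0 <= rho c by rewrite fine_ge0// integral_ge0.
have rhoE (a p : nat) : \sum_(i < p) rho (a + i)%N =
    fine (\int[mu]_(x in cells k' a p)
      (`|f x - s x|)%:E).
  rewrite -integral_cells// sum_fine// => i _.
  by apply: rho_fin; exact: measurable_cell.
have rhole (a p : nat) : \sum_(i < p) rho (a + i)%N <= e / 4.
  rewrite rhoE -lee_fin fineK ?rho_fin//; last exact: measurable_cells.
  apply: (le_trans _ (ltW fs)); apply: ge0_subset_integral => //.
  exact: measurable_cells.
pose D i := `|(dlen k)^-1 *: (G (i%:R * dlen k' + dlen k) - G (i%:R * dlen k')) -
        (dlen k')^-1 *: (G (i%:R * dlen k' + dlen k') - G (i%:R * dlen k'))|.
suff [i ile Di] : exists2 i, (i < 2 ^ k')%N & D i <= e.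
  exists (i%:R * dlen k'); split=> //; first exact: node_ge0.
  rewrite -(@ler_pM2l _ 2)// mulr1 mulrA -natrM -[leRHS](dlen2 _ k').
  by rewrite ler_pM2r// ler_nat expnS leq_mul2l ltnW.
(* The weights [dlen k'] of the [2 ^ k'] nodes add up to 1, so a mean error at most [e] forces one
   error at most [e]. *)
suff sumD : \sum_(i < 2 ^ k') dlen k' * D i <= e.
  apply: contrapT => nex; move: sumD; apply/negP; rewrite -ltNge.
  rewrite [ltLHS](_ : e = \sum_(i < 2 ^ k') dlen k' * e); last first.
    rewrite sumr_const card_ord -mulr_natl mulrA /dlen natrX divff ?mul1r//.
  have n0 : (0 < 2 ^ k')%N by rewrite expn_gt0.
  apply: ltr_sum => [|i _]; first by apply/hasP; exists (Ordinal n0); rewrite ?mem_index_enum.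
  by rewrite ltr_pM2l// ltNge; apply/negP => Di; apply: nex; exists i.
(* The three terms come from replacing [f] by [s] in the window mean, from replacing it on cell [i],
   and from comparing the two means of [s]. Multiplying [D i] by [dlen k'] turns the window quotient
   into an average over [q] cells. *)
have key i : (i < 2 ^ k')%N -> dlen k' * D i <=
    (\sum_(j < q) rho (i + j)%N) / q%:R + rho i +
    \sum_(v <- r) `|v| * `|(\sum_(j < q) mass k' (i + j)%N (s @^-1` [set v])) / q%:R
       - mass k' i (s @^-1` [set v])|.
  move=> ik.
  have step p : (p <= 2 ^ k')%N -> `|G (i%:R * dlen k' + p%:R * dlen k') - G (i%:R * dlen k') -
      \sum_(v <- r) (\sum_(j < p) mass k' (i + j)%N (s @^-1` [set v])) *: v| <=
      \sum_(j < p) rho (i + j)%N.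
    move=> pk; have ip : (i + p <= 2 ^ k'.+1)%N.
      by rewrite expnS mul2n -addnn leq_add// ltnW.
    rewrite -(simple_integral_cells ur rE ss ip) -mulrDl -natrD.
    rewrite -(nu_itv L0 GL) ?node_ge0 ?node_le2//; last first.
      by rewrite ler_pM2r// ler_nat leq_addr.
    have mJ : measurable (@cells R k' i p) by exact: measurable_cells.
    have Joo : (mu (cells k' i p) < +oo)%E.
      by rewrite /cells mu_itv ?ltry// ler_pM2r// ler_nat leq_addr.
    rewrite rhoE -lee_fin fineK ?rho_fin//.
    exact: (bochner_integral_dist_le cmu mf ss mJ Joo (If _ mJ)).
  have := step q qk'; have := step 1%N (leq_ltn_trans (leq0n i) ik).
  rewrite -hq mul1r.
  set A := G _ - G _; set B := G _ - G _.
  rewrite big_ord1 addn0.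
  set a := \sum_(v <- r) _; set b := \sum_(v <- r) _ => h1 h2.
  have -> : dlen k' * D i = `|q%:R^-1 *: B - A|.
    rewrite /D -{1}(gtr0_norm h'0) -normrZ scalerBr !scalerA mulfV ?gt_eqF// scale1r.
    by rewrite hE.
  have -> : q%:R^-1 *: B - A = q%:R^-1 *: (B - b) - (A - a) + (q%:R^-1 *: b - a).
    by rewrite [in RHS]scalerBr; exact: aux.
  rewrite (le_trans (ler_normD _ _))// lerD//.
    rewrite (le_trans (ler_normB _ _))// lerD//.
    by rewrite normrZ ger0_norm ?invr_ge0// mulrC ler_pM2r ?invr_gt0 ?ltr0n.
  rewrite scaler_sumr -sumrB (le_trans (ler_norm_sum _ _ _))//.
  apply: ler_sum => v _; rewrite scalerA -scalerBl normrZ mulrC ler_wpM2l//.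
  by rewrite big_ord1 addn0 mulrC.
(* One [e / 4] for each replacement of [f], and the [slide] bound weighted by the norms of the
   values of [s], whose sum is [M]; [M + 1] avoids division by zero. *)
apply: (@le_trans _ _ (e / 4 + e / 4 + M * (e / (4 * (M + 1))))); last first.
  rewrite (@le_trans _ _ (e / 4 + e / 4 + (M + 1) * (e / (4 * (M + 1)))))//.
    rewrite lerD2l ler_wpM2r ?lerDl//.
    by rewrite divr_ge0 ?(ltW e0)// mulr_ge0// addr_ge0.
  have M1 : M + 1 != 0 by rewrite gt_eqF// ltr_wpDl.
  rewrite [leLHS](_ : _ = 3 * e / 4); first by lra.
  by field.
rewrite (le_trans (ler_sum _ (fun (i : 'I_(2 ^ k')) _ => key i (ltn_ord i))))//.
rewrite !big_split/= !lerD//.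
- by apply: sum_window => // j; exact: rhole.
- by rewrite (eq_bigr (fun i : 'I__ => rho (0 + i)%N))// rhole.
rewrite exchange_big/= mulr_suml big_seq [leRHS]big_seq.
by apply: ler_sum => v vr; rewrite -mulr_sumr ler_wpM2l//; exact: hN.
Qed.

End radon_nikodym_dyadic.

(** * Lebesgue measure on R^n *)

Section lebesgue_rn.
Context (R : realType) (n : nat).
Notation T := 'rV[R]_n.+1.
Notation mu := (@lebn R n).
Notation LS := (lebspace R n).
Implicit Types (x h : T) (A : set T).

Definition set_coord (i : 'I_n.+1) (r : R) x : T :=
  \row_j (if j == i then r else x 0 j).

Lemma box_vol_coord (i : 'I_n.+1) (p : T * T) : box_vol p =
  (p.2 0 i - p.1 0 i) * \prod_(j < n.+1 | j != i) (p.2 0 j - p.1 0 j).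
Proof. by rewrite /box_vol (bigD1 i). Qed.

(** The hyperplane cuts each box of a cover into two boxes whose volumes add up. Clamping the level
    [c] to the side of the box makes one part degenerate, of volume 0, when the hyperplane misses
    the box. *)
Lemma measurable_halfspace (i : 'I_n.+1) (c : R) :
  measurable ([set x | x 0 i <= c] : set LS).
Proof.
apply: le_caratheodory_measurable => X; set H := [set x | _].
apply: le_ereal_inf_tmp => _ [ab [abk Xab] <-].
pose ab1 k := ((ab k).1,
  set_coord i (Num.max ((ab k).1 0 i) (Num.min ((ab k).2 0 i) c)) (ab k).2).
pose ab2 k :=
  (set_coord i (Num.min ((ab k).2 0 i) (Num.max ((ab k).1 0 i) c)) (ab k).1,
   (ab k).2).
have c1 : box_cover (X `&` H) ab1.
  split=> [k j|x [Xx Hx]].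
    rewrite mxE; case: eqP => [->|_]; last exact: abk.
    by rewrite le_max lexx.
  have [k _ bx] := Xab _ Xx; exists k => // j; rewrite mxE /=.
  case: eqP => [->|_]; last exact: bx.
  have /andP[-> b2] := bx i; rewrite le_max le_min b2 [x 0 i <= c]Hx.
  by rewrite orbT.
have c2 : box_cover (X `&` ~` H) ab2.
  split=> [k j|x [Xx /negP]].
    rewrite mxE; case: eqP => [->|_]; last exact: abk.
    by rewrite ge_min lexx.
  rewrite -ltNge => Hx.
  have [k _ bx] := Xab _ Xx; exists k => // j; rewrite mxE /=.
  case: eqP => [->|_]; last exact: bx.
  have /andP[b1 ->] := bx i; rewrite gt_min gt_max b1 Hx.
  by rewrite orbT.
apply: (@le_trans _ _ (\sum_(0 <= k <oo) (box_vol (ab1 k))%:E +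
    \sum_(0 <= k <oo) (box_vol (ab2 k))%:E)%E).
  by apply: leeD; apply: ereal_inf_lbound; [exists ab1|exists ab2].
rewrite -nneseriesD; last 2 first.
- by move=> k *; exact: (box_vol_ge0 k c1).
- by move=> k *; exact: (box_vol_ge0 k c2).
rewrite le_eqVlt; apply/orP; left; apply/eqP; apply: eq_eseriesr => k _.
  rewrite -EFinD !(box_vol_coord i) /=; congr (_%:E).
  have E1 : \prod_(j < n.+1 | j != i) ((ab1 k).2 0 j - (ab1 k).1 0 j) =
      \prod_(j < n.+1 | j != i) ((ab k).2 0 j - (ab k).1 0 j).
    by apply: eq_bigr => j ji; rewrite /= mxE (negbTE ji).
  have E2 : \prod_(j < n.+1 | j != i) ((ab2 k).2 0 j - (ab2 k).1 0 j) =
      \prod_(j < n.+1 | j != i) ((ab k).2 0 j - (ab k).1 0 j).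
    by apply: eq_bigr => j ji; rewrite /= mxE (negbTE ji).
  rewrite E1 E2 -mulrDl !mxE eqxx; congr (_ * _).
  have := abk k i; set a := _ 0 i; set b := _ 0 i => ab_.
  by rewrite /Num.max /Num.min; do ![case: ifPn]; rewrite -?leNgt; lra.
Qed.

Lemma measurable_box (a b : T) : measurable (box a b : set LS).
Proof.
have -> : box a b = \bigcap_(i in [set: 'I_n.+1])
    (~` [set x | x 0 i <= a 0 i] `&` [set x | x 0 i <= b 0 i]).
  apply/seteqP; split=> x bx i; [move=> _|].
    by have /andP[ai bi] := bx i; split=> //=; apply/negP; rewrite -ltNge.
  by have [/= /negP] := bx i I; rewrite -ltNge => -> ->.
apply: fin_bigcap_measurable; first exact: finite_finset.
move=> i _; apply: measurableI; last exact: measurable_halfspace.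
by apply: measurableC; exact: measurable_halfspace.
Qed.

(** An open set is the union of the countably many boxes with rational corners that it contains,
    since balls of the sup norm are cubes. *)
Lemma open_lebn A : open A -> measurable (A : set LS).
Proof.
move=> oA.
pose rv (p : 'rV[rat]_n.+1) : T := \row_i ratr (p 0 i).
have -> : A = \bigcup_(p in [set: 'rV[rat]_n.+1 * 'rV[rat]_n.+1])
    (if `[< box (rv p.1) (rv p.2) `<=` A >] then box (rv p.1) (rv p.2) else set0).
  apply/seteqP; split=> [x Ax|x [p _]]; last by case: asboolP => // h /h.
  have /nbhs_ballP[e /= e0 xeA] : nbhs x A by exact: open_nbhs_nbhs.
  have lo i : exists q : rat, x 0 i - e < ratr q < x 0 i.
    have [|q] := @rat_in_itvoo R (x 0 i - e) (x 0 i); first by lra.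
    by rewrite in_itv => h; exists q.
  have hi i : exists q : rat, x 0 i < ratr q < x 0 i + e.
    have [|q] := @rat_in_itvoo R (x 0 i) (x 0 i + e); first by lra.
    by rewrite in_itv => h; exists q.
  have [p hp] := choice lo; have [q hq] := choice hi.
  exists (\row_i p i, \row_i q i) => //=; case: asboolP => [_ i|[]].
    rewrite !mxE; have := hp i; have := hq i; lra.
  move=> y by_; apply: xeA; split=> // i j; rewrite ord1.
  have := by_ j; rewrite !mxE => /andP[y1 y2]; rewrite -ball_normE /=.
  have := hp j; have := hq j; rewrite ltr_norml; lra.
apply: countable_bigcupT_measurable; first exact: countableP.
by move=> p; case: asboolP => // _; exact: measurable_box.
Qed.

Lemma closed_lebn A : closed A -> measurable (A : set LS).
Proof.
by move=> cA; rewrite -[A]setCK; apply/measurableC/open_lebn; rewrite openC.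
Qed.

Lemma continuous_lebn (D : set LS) (f : T -> R) : measurable D ->
  continuous f -> measurable_fun D (f : LS -> R).
Proof.
move=> mD cf; apply: (measurability _ (RGenOInfty.measurableE R)) => //.
move=> _ [_ [c ->] <-]; apply: measurableI => //; apply: open_lebn.
apply: (@open_comp _ _ f); first by move=> x _; exact: cf.
exact: interval_open.
Qed.

Lemma box_leb_outer (a b : T) : (forall i, a 0 i <= b 0 i) ->
  (leb_outer (box a b) <= (box_vol (a, b))%:E)%E.
Proof.
move=> ab; pose c k : T * T := if k is 0 then (a, b) else (0, 0).
have cc : box_cover (box a b) c.
  by split=> [[|k] i|x bx]; [exact: ab|exact: lexx|exists 0].
apply: (@le_trans _ _ (\sum_(0 <= k <oo) (box_vol (c k))%:E)%E).
  by apply: ereal_inf_lbound; exists c.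
rewrite nneseries_recl//; last by move=> k _; exact: (box_vol_ge0 k cc).
rewrite eseries0 ?adde0// => -[|k]// _ _.
by rewrite /box_vol /= big_ord_recl subrr mul0r.
Qed.

Lemma bounded_lebn A : bounded_set A -> (mu A < +oo)%E.
Proof.
move=> [M [_ MA]]; pose r : R := `|M| + 1.
have rA x : A x -> `|x| <= r by apply: MA; rewrite /r; have := ler_norm M; lra.
(* Boxes are open on the left, hence the extra [- 1]. *)
pose a : T := \row_i (- r - 1); pose b : T := \row_i r.
have r0 : 0 <= r by rewrite /r addr_ge0.
apply: (@le_lt_trans _ _ (leb_outer (box a b))); last first.
  by rewrite (le_lt_trans (box_leb_outer _)) ?ltry// => i; rewrite !mxE; lra.
apply: le_leb_outer => x /rA xr i; rewrite !mxE.
have : `|x 0 i| <= r.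
  by apply: le_trans xr; rewrite /Num.norm/= mx_normrE; exact: (le_bigmax _ _ (0, i)).
by rewrite ler_norml; lra.
Qed.

Lemma lebn_complete : measure_is_complete mu.
Proof. exact: measure_is_complete_caratheodory. Qed.

Definition translate h x : T := x + h.

Lemma le_leb_outer_shift h A :
  (leb_outer (translate h @^-1` A) <= leb_outer A)%E.
Proof.
apply: le_ereal_inf_tmp => _ [ab [abk Aab] <-].
pose c k := ((ab k).1 - h, (ab k).2 - h).
have -> : (\sum_(0 <= k <oo) (box_vol (ab k))%:E =
    \sum_(0 <= k <oo) (box_vol (c k))%:E)%E.
  apply: eq_eseriesr => k _; congr (_%:E); apply: eq_bigr => i _ /=.
  by rewrite !mxE; lra.
apply: ereal_inf_lbound; exists c => //; split=> [k i|x /= /Aab [k _ bx]].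
  by rewrite !mxE lerB.
by exists k => // i; have := bx i; rewrite !mxE; lra.
Qed.

Lemma leb_outer_shift h A : leb_outer (translate h @^-1` A) = leb_outer A.
Proof.
apply/eqP; rewrite eq_le le_leb_outer_shift/=.
rewrite (le_trans _ (le_leb_outer_shift (- h) _))// le_leb_outer// => x Ax.
by rewrite /translate /= subrK.
Qed.

(** Every test set of the Caratheodory condition is itself a preimage under the translation, so the
    condition carries over by invariance of the outer measure. *)
Lemma measurable_shift h : measurable_fun setT (translate h : LS -> LS).
Proof.
move=> _ A mA; rewrite setTI.
have {}mA : caratheodory_measurable (@leb_outer R n) A := mA.
suff : caratheodory_measurable (@leb_outer R n) (translate h @^-1` A) by [].
move=> X.
have [Y ->] : exists Y, X = translate h @^-1` Y.
  exists (translate (- h) @^-1` X).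
  by apply/seteqP; split=> x /=; rewrite /translate addrK.
have := mA Y; rewrite -(leb_outer_shift h Y) -(leb_outer_shift h (Y `&` A)).
by rewrite -(leb_outer_shift h (Y `&` ~` A)).
Qed.

Lemma ge0_integral_shift h (D : set LS) (f : LS -> \bar R) : measurable D ->
  measurable_fun D f -> (forall x, D x -> 0 <= f x)%E ->
  (\int[mu]_(x in D) f x = \int[mu]_(x in translate h @^-1` D) f (translate h x))%E.
Proof.
move=> mD mf f0; rewrite -(@ge0_integral_pushforward _ _ _ _ _ _ (measurable_shift h))//.
  apply: eq_measure_integral => [|? A mA _]; first exact: measurable_shift.
  exact/esym/(leb_outer_shift h A).
by move=> x /set_mem; exact: f0.
Qed.

Lemma integral_shift h (f : LS -> \bar R) : measurable_fun setT f ->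
  (\int[mu]_x f x = \int[mu]_x f (translate h x))%E.
Proof.
move=> mf; rewrite [LHS]integralE [RHS]integralE; congr (_ - _)%E.
  have mfp := measurable_funepos mf.
  rewrite (ge0_integral_shift h measurableT mfp)// preimage_setT.
  by apply: eq_integral => x _; rewrite !funeposE.
have mfn := measurable_funeneg mf.
rewrite (ge0_integral_shift h measurableT mfn)// preimage_setT.
by apply: eq_integral => x _; rewrite !funenegE.
Qed.

End lebesgue_rn.

(** * Limits in L^1 *)

Section L1_limits.
Context d (T : measurableType d) (R : realType) (mu : {measure set T -> \bar R}).

(** By monotone convergence the sum of the terms from index [p] on has finite integral, so it is
    finite a.e.; the first [p] terms are real-valued and do not affect convergence. *)
Lemma geometric_integrals_summable (E : set T) (b : nat -> T -> R) (p : nat) :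
  measurable E -> (forall k, measurable_fun E (b k)) ->
  (forall k x, E x -> 0 <= b k x) ->
  (forall k, (p <= k)%N -> \int[mu]_(x in E) (b k x)%:E <= (2 ^- k)%:E)%E ->
  {ae mu, forall x, E x -> cvgn (series (b ^~ x))}.
Proof.
move=> mE mb b0 ib.
have mb' k : measurable_fun E (fun x => (b (k + p)%N x)%:E) by exact/measurable_EFinP.
pose S x : \bar R := (\sum_(k <oo) (b (k + p)%N x)%:E)%E.
have S0 x : E x -> (0 <= S x)%E.
  by move=> Ex; apply: nneseries_ge0 => k _ _; rewrite lee_fin b0.
have mS : measurable_fun E S.
  by apply: ge0_emeasurable_sum => // k x Ex _; rewrite lee_fin b0.
have iS : mu.-integrable E S.
  apply/integrableP; split=> //.
  rewrite (eq_integral S); last by move=> x /set_mem Ex; rewrite gee0_abs// S0.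
  rewrite /S integral_nneseries//; last by move=> k x Ex; rewrite lee_fin b0.
  (* The bound 2^-k is written as [2 / 2 ^ k.+1], the shape of the geometric series in
     [epsilon_trick0]. *)
  apply: (@le_lt_trans _ _ (\sum_(k <oo) (2 / (2 ^ k.+1)%:R)%:E)%E); last first.
    by rewrite (le_lt_trans (epsilon_trick0 xpredT _))// ltry.
  apply: lee_nneseries => [k _ _|k _].
    by apply: integral_ge0 => x Ex; rewrite lee_fin b0.
  rewrite (le_trans (ib _ (leq_addl _ _)))// lee_fin expnS natrM invfM mulVKf// natrX.
  by rewrite lef_pV2 ?posrE ?exprn_gt0// ler_weXn2l ?ler1n ?leq_addr.
have := integrable_ae mE iS; apply: filterS => x Sx Ex.
have Sfin := Sx Ex.
apply: nondecreasing_is_cvgn.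
  by apply: nondecreasing_series => k _ _; exact: b0.
exists (series (b ^~ x) p + fine (S x)) => _ [m _ <-].
apply: (@le_trans _ _ (series (b ^~ x) (p + m)%N)).
  by apply: nondecreasing_series => [k _ _|]; [exact: b0|exact: leq_addl].
rewrite /series/= (@big_cat_nat _ _ _ p)//= ?leq_addr// lerD2l.
rewrite -{1}[p]add0n big_addn addKn -lee_fin fineK// -sumEFin.
by apply: nneseries_lim_ge => k _ _; rewrite lee_fin b0.
Qed.

Lemma L1_cvg0_ae_subseq (E : set T) (b : nat -> T -> R) :
  measurable E -> (forall k, measurable_fun E (b k)) ->
  (forall k x, E x -> 0 <= b k x) ->
  (forall e, 0 < e -> exists N, forall k, (N <= k)%N ->
     (\int[mu]_(x in E) (b k x)%:E <= e%:E)%E) ->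
  exists sigma : nat -> nat,
    {ae mu, forall x, E x -> b (sigma k) x @[k --> \oo] --> 0}.
Proof.
move=> mE mb b0 ib.
have [sigma hs] : {sigma : nat -> nat & forall k,
    (\int[mu]_(x in E) (b (sigma k) x)%:E <= (2 ^- k)%:E)%E}.
  apply: (@choice _ _ (fun k m => \int[mu]_(x in E) (b m x)%:E <= (2 ^- k)%:E)%E) => k.
  have [|N hN] := ib (2 ^- k); first by rewrite invr_gt0 exprn_gt0.
  by exists N; exact: hN.
exists sigma.
have := @geometric_integrals_summable E (b \o sigma) 0 mE (fun k => mb _)
  (fun k => b0 _) (fun k _ => hs k).
by apply: filterS => x h /h; exact: cvg_series_cvg_0.
Qed.

Hypothesis cmu : measure_is_complete mu.

Lemma limn_einf_le (v : nat -> \bar R) (c : \bar R) (J : nat) :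
  (forall j, (J <= j)%N -> v j <= c)%E -> (limn_einf v <= c)%E.
Proof.
move=> vc; rewrite limn_einf_lim; apply: lime_le; first exact: is_cvg_einfs.
apply: nearW => k; apply: (@le_trans _ _ (v (maxn J k))); last first.
  by apply: vc; exact: leq_maxl.
by apply: ereal_inf_lbound; exists (maxn J k) => //=; exact: leq_maxr.
Qed.

(** A diagonal subsequence has geometric increments: on [E p], the step from [sigma k] to
    [sigma k.+1] is at most 2^-k as soon as [p <= k], because [E p] is contained in [E k]. This
    gives the a.e. limit, and Fatou's lemma then yields L^1 convergence of the whole sequence on
    each [E p]. *)
Lemma L1loc_complete (Omega : set T) (E : nat -> set T) (g : nat -> T -> R) :
  measurable Omega -> (forall p, measurable (E p)) ->
  (forall p, E p `<=` Omega) -> (forall p, E p `<=` E p.+1) ->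
  Omega `<=` \bigcup_p E p -> (forall k, measurable_fun Omega (g k)) ->
  (forall p e, 0 < e -> exists N, forall k k', (N <= k)%N -> (N <= k')%N ->
     (\int[mu]_(x in E p) (`|g k x - g k' x|)%:E <= e%:E)%E) ->
  exists (w : T -> R) (sigma : nat -> nat),
    [/\ measurable_fun Omega w, forall k, (k <= sigma k)%N,
        {ae mu, forall x, Omega x -> g (sigma k) x @[k --> \oo] --> w x} &
        forall p e, 0 < e -> exists N, forall k, (N <= k)%N ->
          (\int[mu]_(x in E p) (`|g k x - w x|)%:E <= e%:E)%E].
Proof.
move=> mO mE EO Einc OE mg cg.
have homoE : {homo E : p q / (p <= q)%N >-> p `<=` q}.
  apply: homo_leq; [by move=> A|by move=> B A C AB BC; exact: subset_trans AB BC|exact: Einc].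
have [N hN] : {N : nat -> nat & forall p k k', (N p <= k)%N -> (N p <= k')%N ->
    (\int[mu]_(x in E p) (`|g k x - g k' x|)%:E <= (2 ^- p)%:E)%E}.
  apply: (@choice _ _ (fun p m => forall k k', (m <= k)%N -> (m <= k')%N ->
    (\int[mu]_(x in E p) (`|g k x - g k' x|)%:E <= (2 ^- p)%:E)%E)) => p.
  by apply: cg; rewrite invr_gt0 exprn_gt0.
pose sigma := fix s k := if k is k'.+1 then maxn (s k').+1 (N k) else N 0%N.
have sN k : (N k <= sigma k)%N by case: k => [|k] //=; rewrite leq_maxr.
have sS k : (sigma k < sigma k.+1)%N by rewrite /= leq_maxl.
have sk k : (k <= sigma k)%N by elim: k => // k IH; exact: leq_ltn_trans (sS k).
have mgE p k : measurable_fun (E p) (g k) by exact: measurable_funS (mg k).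
pose w x := lim (g (sigma k) x @[k --> \oo]).
have ae_cvg : {ae mu, forall x, Omega x -> g (sigma k) x @[k --> \oo] --> w x}.
  have aeE p : {ae mu, forall x, E p x -> cvgn (fun k => g (sigma k) x)}.
    have mb k : measurable_fun (E p) (fun x => `|g (sigma k.+1) x - g (sigma k) x|).
      by apply: measurableT_comp => //; exact: measurable_funB.
    have := @geometric_integrals_summable (E p)
      (fun k x => `|g (sigma k.+1) x - g (sigma k) x|) p (mE p) mb
      (fun k x _ => normr_ge0 _).
    have ib k : (p <= k)%N -> (\int[mu]_(x in E p)
        (`|g (sigma k.+1) x - g (sigma k) x|)%:E <= (2 ^- k)%:E)%E.
      move=> pk; apply: (le_trans _ (hN k (sigma k.+1) (sigma k) _ _)) => //.
        apply: ge0_subset_integral => //; last exact: homoE.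
        by apply/measurable_EFinP; apply: measurableT_comp => //; exact: measurable_funB.
      by rewrite (leq_trans (sN k))// ltnW.
    move/(_ ib); apply: filterS => x h /h /normed_cvg.
    rewrite (_ : (fun k => _) = telescope (fun k => g (sigma k) x))//.
    rewrite telescopeK => /cvg_ex[l hl]; apply/cvg_ex; exists (l + g (sigma 0%N) x).
    rewrite (_ : (fun k => _) = (fun k => (g (sigma k) x - g (sigma 0%N) x) + g (sigma 0%N) x)).
      by apply: cvgD => //; exact: cvg_cst.
    by apply/funext => k; rewrite subrK.
  have := ae_foralln aeE; apply: filterS => x h Ox.
  by have [p _ /h] := OE x Ox.
have mw : measurable_fun Omega w.
  exact: (ae_cvg_measurable cmu mO (fun k => mg (sigma k)) ae_cvg).
exists w, sigma; split=> // p e e0; have [M hM] := cg p e e0; exists M => k Mk.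
have mwE : measurable_fun (E p) w by exact: measurable_funS mw.
have mgs j : measurable_fun (E p) (fun x => (`|g k x - g (sigma j) x|)%:E).
  by apply/measurable_EFinP; apply: measurableT_comp => //; exact: measurable_funB.
have mgw : measurable_fun (E p) (fun x => (`|g k x - w x|)%:E).
  by apply/measurable_EFinP; apply: measurableT_comp => //; exact: measurable_funB.
(* Fatou's lemma bounds the integral of the pointwise lower limit, which agrees with the distance to
   [w] only a.e. *)
have gwE : {ae mu, forall x, E p x -> (`|g k x - w x|)%:E =
    limn_einf (fun j => (`|g k x - g (sigma j) x|)%:E)}.
  apply: filterS ae_cvg => x h /(EO p) /h hx; apply/esym.
  have : (`|g k x - g (sigma j) x|)%:E @[j --> \oo] --> (`|g k x - w x|)%:E.
    apply: cvg_EFin; first exact: nearW.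
    by apply: cvg_norm; apply: cvgB => //; exact: cvg_cst.
  by move/cvg_limn_einf_sup => [].
rewrite (@ge0_ae_eq_integral _ _ _ mu (E p) _
    (fun x => limn_einf (fun j => (`|g k x - g (sigma j) x|)%:E)))//.
- apply: (le_trans (fatou mu (mE p) mgs _)) => //.
  apply: (@limn_einf_le _ _ M) => j Mj; apply: hM => //.
  by rewrite (leq_trans Mj).
- exact: (ae_measurable_fun cmu gwE mgw).
- move=> x _; rewrite limn_einf_lim; apply: lime_ge; first exact: is_cvg_einfs.
  by apply: nearW => j; apply: le_ereal_inf_tmp => _ [m _ <-].
Qed.

End L1_limits.

(** * An exhaustion of the domain *)

Section exhaustion.
Context (R : realType) (n : nat) (Omega : set 'rV[R]_n.+1).
Hypothesis openOmega : open Omega.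
Notation T := 'rV[R]_n.+1.
Notation mu := (@lebn R n).
Implicit Types (x y h : T).

Lemma le_coord_norm x i : `|x 0 i| <= `|x|.
Proof. by rewrite [leRHS]/Num.norm/= mx_normrE; exact: (le_bigmax _ _ (0, i)). Qed.

Lemma norm_le_enorm x : `|x| <= enorm x.
Proof.
rewrite [leLHS]/Num.norm/= mx_normrE; apply/bigmax_leP; split=> [|[i j] _].
  exact: sqrtr_ge0.
rewrite /= ord1 -sqrtr_sqr ler_sqrt ?sumr_ge0//; last by move=> k _; exact: sqr_ge0.
by rewrite (bigD1 j)//= lerDl sumr_ge0// => k _; exact: sqr_ge0.
Qed.

Lemma enorm_le_sum x : enorm x <= \sum_(i < n.+1) `|x 0 i|.
Proof.
have s0 : 0 <= \sum_(i < n.+1) `|x 0 i| by apply: sumr_ge0.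
rewrite -[leRHS]ger0_norm// -sqrtr_sqr ler_sqrt ?sqr_ge0//.
rewrite expr2 mulr_suml; apply: ler_sum => i _.
rewrite -[leLHS]real_normK ?num_real// expr2 ler_wpM2l//.
by rewrite (bigD1 i)//= lerDl sumr_ge0.
Qed.

Lemma norm_stdvec (j : 'I_n.+1) (t : R) : `|t *: stdvec j : T| = `|t|.
Proof.
apply/eqP; rewrite eq_le; apply/andP; split; last first.
  by have := le_coord_norm (t *: stdvec j) j; rewrite !mxE !eqxx mulr1.
rewrite [leLHS]/Num.norm/= mx_normrE; apply/bigmax_leP; split=> // -[i k] _ /=.
by rewrite !mxE; case: (_ && _); rewrite ?mulr1// mulr0 normr0.
Qed.

(** Bounded points with a margin greater than 2^-p, in the sup norm, inside [Omega]. The radius [r],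
    strictly larger than 2^-p, makes the set open and allows shifts of length exactly 2^-p. *)
Definition om (p : nat) : set T :=
  [set x | `|x| < 2 ^+ p /\ exists2 r, dlen p < r & ball x r `<=` Omega].

(** The margin 2^-p is spent in two halves: one on the shift, the other left as the margin of the
    next set. *)
Lemma om_shift p x h : om p x -> `|h| <= dlen p.+1 -> om p.+1 (x + h).
Proof.
move=> [xp [r pr xr]] hp; split.
  rewrite (le_lt_trans (ler_normD _ _))//.
  have : `|h| <= 1 by rewrite (le_trans hp)// invf_le1 ?exprn_gt0// exprn_ege1// ler1n.
  have : (1 : R) <= 2 ^+ p by rewrite exprn_ege1// ler1n.
  by rewrite exprS; lra.
exists (r - dlen p.+1).
  have -> : dlen p.+1 = dlen p / 2 :> R by rewrite /dlen exprS invfM mulrC.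
  by move: pr; have := @dlen_gt0 R p; lra.
move=> y; rewrite -ball_normE /= => xhy; apply: xr; rewrite -ball_normE/=.
have -> : x - y = (x + h - y) - h by rewrite addrAC addrK.
by rewrite (le_lt_trans (ler_normB _ _))//; lra.
Qed.

Lemma om_sub p : om p `<=` om p.+1.
Proof.
by move=> x xp; rewrite -[x]addr0; apply: om_shift => //; rewrite normr0 ltW// dlen_gt0.
Qed.

Lemma le_om p q : (p <= q)%N -> om p `<=` om q.
Proof.
move=> /subnK <-; elim: (q - p)%N => // k IH x /IH; exact: om_sub.
Qed.

Lemma om_in p x h : om p x -> `|h| <= dlen p -> Omega (x + h).
Proof.
move=> [xp [r pr xr]] hp; apply: xr; rewrite -ball_normE/= opprD addNKr normrN.
exact: le_lt_trans pr.
Qed.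

Lemma om_Omega p : om p `<=` Omega.
Proof.
by move=> x xp; rewrite -[x]addr0; apply: om_in xp _; rewrite normr0 ltW// dlen_gt0.
Qed.

Lemma om_open p : open (om p).
Proof.
rewrite openE => x [xp [r pr xr]]; rewrite /interior/=; apply/nbhs_ballP.
pose d := Num.min (2 ^+ p - `|x|) ((r - dlen p) / 2).
have d0 : 0 < d by rewrite lt_min subr_gt0 xp divr_gt0// subr_gt0.
have d1 : d <= 2 ^+ p - `|x| by rewrite ge_min lexx.
have d2 : d <= (r - dlen p) / 2 by rewrite ge_min lexx orbT.
exists d => // y; rewrite -ball_normE /= => xy; split.
  have -> : y = x - (x - y) by rewrite opprB addrC subrK.
  by rewrite (le_lt_trans (ler_normB _ _))//; lra.
exists (r - d); first by lra.
move=> z; rewrite -ball_normE /= => yz; apply: xr; rewrite -ball_normE /=.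
by rewrite -(subrKA y) (le_lt_trans (ler_normD _ _))//; lra.
Qed.

Lemma om_closure p : closure (om p) `<=`
  [set x | `|x| <= 2 ^+ p + 1 /\ ball x (dlen p) `<=` Omega].
Proof.
move=> x clx; split.
  have [z [[zp _]]] := clx _ (nbhsx_ballx x 1 ltr01); rewrite -ball_normE/= => xz.
  have -> : x = z + (x - z) by rewrite addrC subrK.
  by rewrite (le_trans (ler_normD _ _))//; lra.
move=> y; rewrite -ball_normE /= => xy.
have d0 : 0 < dlen p - `|x - y| by rewrite subr_gt0.
have [z [[_ [r pr zr]]]] := clx _ (nbhsx_ballx x _ d0); rewrite -ball_normE/= => xz.
apply: zr; rewrite -ball_normE /= -(subrKA x) (le_lt_trans (ler_normD _ _))//.
by move: xz; rewrite distrC; lra.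
Qed.

Lemma om_bounded p : bounded_set (om p).
Proof.
exists (2 ^+ p); split; first by rewrite num_real.
by move=> M pM x [xp _] /=; rewrite ltW// (lt_trans xp).
Qed.

Lemma om_compactly_contained p : compactly_contained (om p) Omega.
Proof.
split; first exact: om_open.
- apply: bounded_closed_compact; last exact: closed_closure.
  exists (2 ^+ p + 1); split; first by rewrite num_real.
  by move=> M pM x /om_closure [xp _] /=; rewrite (le_trans xp)// ltW.
- move=> x /om_closure [_]; apply; apply: ballxx; exact: dlen_gt0.
Qed.

(** As [Omega] is open, boundary points lie outside it, so the sup-norm margin bounds their sup
    distance, hence their Euclidean distance, from below. *)
Lemma om_set_dist p : ((dlen p)%:E <= set_dist (om p) (boundary Omega))%E.
Proof.
apply: le_ereal_inf_tmp => _ [x [y [[xp [r pr xr]] [_ yO] ->]]].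
rewrite lee_fin (le_trans _ (norm_le_enorm _))// leNgt; apply/negP => xy.
apply: yO; rewrite (_ : Omega^° = Omega); last first.
  exact/interior_id.
by apply: xr; rewrite -ball_normE /=; exact: lt_trans pr.
Qed.

Lemma om_measurable p : measurable (om p : set (lebspace R n)).
Proof. exact/open_lebn/om_open. Qed.

Lemma om_finite p : (mu (om p) < +oo)%E.
Proof. exact/bounded_lebn/om_bounded. Qed.

Lemma om_cover : Omega `<=` \bigcup_p om p.
Proof.
move=> x Ox; have /nbhs_ballP[r /= r0 xr] : nbhs x Omega by exact: open_nbhs_nbhs.
have r20 : 0 < r / 2 by rewrite divr_gt0.
have [N hN] := dlen_small r20.
pose M := Num.truncn `|x|.
exists (maxn N M.+1) => //; split; last first.
  by exists r => //; rewrite (le_lt_trans (hN _ (leq_maxl _ _)))//; lra.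
rewrite (lt_trans (truncnS_gt _))// -natrX ltr_nat -/M.
by rewrite (leq_ltn_trans _ (ltn_expl _ (ltnSn 1)))// leq_maxr.
Qed.

Lemma compact_om (K : set T) : compact K -> K `<=` Omega -> exists p, K `<=` om p.
Proof.
move=> cK KO; move: (cK); rewrite compact_cover.
move=> /(_ nat setT om (fun p _ => @om_open p)) [|D _ KD].
  by move=> x /KO /om_cover [p _ xp]; exists p.
exists (\max_(i <- finmap.enum_fset D) i)%N => x /KD[p /= pD xp].
by apply: le_om xp; exact: leq_bigmax_seq.
Qed.

End exhaustion.

(** * Banach function spaces *)

Section function_space_norm.
Context (R : realType) (n : nat) (Omega : set 'rV[R]_n.+1).
Context (X : completeNormedModType R) (emb : X -> 'rV[R]_n.+1 -> R).
Hypothesis bfsX : banach_function_space Omega emb.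
Notation T := 'rV[R]_n.+1.
Notation mu := (@lebn R n).
Local Notation Xmem := (Xmem Omega emb).
Local Notation Xnorm := (Xnorm Omega emb).
Implicit Types f g : T -> R.

Lemma ae_on_and (P Q : T -> Prop) : ae_on Omega P -> ae_on Omega Q ->
  ae_on Omega (fun x => P x /\ Q x).
Proof. by rewrite /ae_on; apply: filterS2 => x p q Ox; split; [exact: p|exact: q]. Qed.

Lemma ae_onS (P Q : T -> Prop) : (forall x, Omega x -> P x -> Q x) ->
  ae_on Omega P -> ae_on Omega Q.
Proof. by rewrite /ae_on => PQ; apply: filterS => x p Ox; exact/PQ/p. Qed.

Lemma ae_onW (P : T -> Prop) : (forall x, Omega x -> P x) -> ae_on Omega P.
Proof. by move=> h; apply: aeW => x; exact: h. Qed.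

Lemma ae_onS2 (P Q U : T -> Prop) : (forall x, Omega x -> P x -> Q x -> U x) ->
  ae_on Omega P -> ae_on Omega Q -> ae_on Omega U.
Proof. by rewrite /ae_on => PQ; apply: filterS2 => x p q Ox; exact: (PQ x Ox (p Ox) (q Ox)). Qed.

Lemma XnormE phi f : ae_on Omega (fun x => emb phi x = f x) ->
  Xnorm f = `|phi|%:E.
Proof.
move=> phif; rewrite /Xnorm (_ : [set _ | _ in _] = [set `|phi|%:E]) ?ereal_inf1//.
apply/seteqP; split=> [_ [psi psif <-]|_ ->]; last by exists phi.
suff -> : psi = phi by [].
apply/eqP; rewrite -subr_eq0; apply/eqP; apply: (emb_inj bfsX).
have := emb_linear bfsX (-1) phi psi; rewrite scaleN1r addrC.
by apply: ae_onS2 (ae_on_and phif psif) => x _ [-> ->] ->; rewrite mulN1r addNr.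
Qed.

Lemma Xnorm_lty_mem f : (Xnorm f < +oo)%E -> Xmem f.
Proof.
by move=> /ereal_inf_lt[_ [phi phif _] _]; exists phi.
Qed.

Lemma le_Xnorm f g (c : \bar R) : measurable_on Omega f -> (Xnorm g <= c)%E ->
  (c < +oo)%E -> ae_on Omega (fun x => `|f x| <= g x) ->
  Xmem f /\ (Xnorm f <= c)%E.
Proof.
move=> mf gc coo fg.
have [] := bfs_P1 bfsX mf (Xnorm_lty_mem (le_lt_trans gc coo)) fg.
by move=> Xf fng; split => //; exact: le_trans gc.
Qed.

Lemma XmemD f g : Xmem f -> Xmem g -> Xmem (fun x => f x + g x).
Proof.
move=> [phi phif] [psi psig]; exists (phi + psi).
have := emb_linear bfsX 1 phi psi; rewrite scale1r.
by apply: ae_onS2 (ae_on_and phif psig) => x _ [<- <-] ->; rewrite mul1r.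
Qed.

Lemma XnormD f g : Xmem f -> Xmem g ->
  (Xnorm (fun x => f x + g x)%R <= Xnorm f + Xnorm g)%E.
Proof.
move=> [phi phif] [psi psig].
rewrite (XnormE phif) (XnormE psig) (@XnormE (phi + psi)).
  by rewrite -EFinD lee_fin ler_normD.
have := emb_linear bfsX 1 phi psi; rewrite scale1r.
by apply: ae_onS2 (ae_on_and phif psig) => x _ [<- <-] ->; rewrite mul1r.
Qed.

Lemma emb0 : ae_on Omega (fun x => emb 0 x = 0).
Proof.
have := emb_linear bfsX (-1) 0 0; rewrite scaler0 addr0.
by apply: ae_onS => x _ ->; rewrite mulN1r addNr.
Qed.

Lemma embZ a phi : ae_on Omega (fun x => emb (a *: phi) x = a * emb phi x).
Proof.
have := emb_linear bfsX a phi 0; rewrite addr0.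
by apply: ae_onS2 emb0 => x _ -> ->; rewrite addr0.
Qed.

Lemma embB phi psi : ae_on Omega (fun x => emb (phi - psi) x = emb phi x - emb psi x).
Proof.
have := emb_linear bfsX (-1) psi phi; rewrite scaleN1r addrC.
by apply: ae_onS => x _ ->; rewrite mulN1r addrC.
Qed.

Lemma XnormZ a f : Xmem f -> Xnorm (fun x => a * f x) = (`|a|%:E * Xnorm f)%E.
Proof.
move=> [phi phif]; rewrite (XnormE phif) (@XnormE (a *: phi)).
  by rewrite normrZ EFinM.
by apply: ae_onS2 phif (embZ a phi) => x _ <- ->.
Qed.

Lemma Xmem_sum (I : Type) (s : seq I) (f : I -> T -> R) :
  (forall i, Xmem (f i)) -> Xmem (fun x => \sum_(i <- s) f i x).
Proof.
move=> Xf; elim: s => [|i s IH].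
  by exists 0; apply: ae_onS emb0 => x _ ->; rewrite big_nil.
rewrite (_ : (fun x => _) = (fun x => f i x + \sum_(j <- s) f j x)).
  exact: XmemD.
by apply/funext => x; rewrite big_cons.
Qed.

Lemma Xnorm_sum_le (I : Type) (s : seq I) (f : I -> T -> R) (c : R) :
  (forall i, Xnorm (f i) <= c%:E)%E ->
  (Xnorm (fun x => \sum_(i <- s) f i x)%R <= ((size s)%:R * c)%:E)%E.
Proof.
move=> fc; have Xf i : Xmem (f i).
  by apply: Xnorm_lty_mem; rewrite (le_lt_trans (fc i))// ltry.
elim: s => [|i s IH].
  rewrite (@XnormE 0) ?normr0 ?mul0r//.
  by apply: ae_onS emb0 => x _ ->; rewrite big_nil.
rewrite (_ : (fun x => _) = (fun x => f i x + \sum_(j <- s) f j x)); last first.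
  by apply/funext => x; rewrite big_cons.
rewrite (le_trans (XnormD _ _))//; first exact: Xmem_sum.
by rewrite /= -natr1 mulrDl mul1r EFinD addeC leeD.
Qed.

(* A Fatou lemma: (P1) bounds the infima over the tails, and (P2) passes to
   their increasing limit. *)
Lemma Xnorm_fatou (a : nat -> T -> R) f (c : R) :
  (forall k, measurable_on Omega (a k)) -> measurable_on Omega f ->
  (forall k x, Omega x -> 0 <= a k x) -> (forall k, Xnorm (a k) <= c%:E)%E ->
  ae_on Omega (fun x => a k x @[k --> \oo] --> f x) ->
  (Xnorm f <= c%:E)%E.
Proof.
move=> ma mf a0 ac af.
pose b k x := infs (a ^~ x) k.
have lb x : Omega x -> has_lbound (range (a ^~ x)).
  by move=> Ox; exists 0 => _ [k _ <-]; exact: a0.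
have mb k : measurable_on Omega (b k) by exact: measurable_fun_infs.
have b0 k x : Omega x -> 0 <= b k x.
  move=> Ox; apply: lb_le_inf; first by exists (a k x); exists k => /=.
  by move=> _ [m _ <-]; exact: a0.
have ba k x : Omega x -> b k x <= a k x.
  move=> Ox; apply: ge_inf; last by exists k => /=.
  exact: (has_lbound_sdrop (lb x Ox)).
have bc k : (Xnorm (b k) <= c%:E)%E.
  have [] := @le_Xnorm (b k) (a k) c%:E (mb k) (ac k) (ltry _) => //.
  by apply: ae_onW => x Ox; rewrite ger0_norm ?b0// ba.
have [_ bf] : {homo Xnorm \o b : k m / (k <= m)%N >-> (k <= m)%E} /\
    Xnorm \o b @ \oo --> Xnorm f.
  apply: (bfs_P2 bfsX mb mf); apply: ae_onS af => x Ox ax; split.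
  - by move=> k; exact: b0.
  - by move=> k m km; exact: (nondecreasing_infs (lb x Ox)).
  - exact: cvg_infs.
by apply: (cvge_to_le bf); exact: nearW.
Qed.

End function_space_norm.

(** * Essential supremum of a family of functions *)

Section essential_supremum.
Context (R : realType) (n : nat) (Omega : set 'rV[R]_n.+1).
Hypothesis openOmega : open Omega.
Context (X : completeNormedModType R) (emb : X -> 'rV[R]_n.+1 -> R).
Hypothesis bfsX : banach_function_space Omega emb.
Notation T := 'rV[R]_n.+1.
Notation mu := (@lebn R n).
Local Notation om := (om Omega).
Context (I : Type) (w : I -> T -> R).

Definition seqmax (s : seq I) (x : T) : R := \big[Num.max/0]_(i <- s) `|w i x|.

Lemma seqmax_ge0 s x : 0 <= seqmax s x.
Proof. exact: bigmax_ge_id. Qed.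

Lemma seqmax_cat s t x : seqmax (s ++ t) x = Num.max (seqmax s x) (seqmax t x).
Proof.
elim: s => [|i s IH]; first by rewrite /seqmax big_nil max_r// seqmax_ge0.
by rewrite /seqmax /= !big_cons -/(seqmax _ x) IH maxA.
Qed.

Lemma seqmax_cons i s x : seqmax (i :: s) x = Num.max `|w i x| (seqmax s x).
Proof. by rewrite /seqmax big_cons. Qed.

Hypothesis mw : forall i, measurable_on Omega (w i).

Lemma seqmax_measurable s : measurable_on Omega (seqmax s).
Proof.
elim: s => [|i s IH].
  rewrite (_ : seqmax _ = cst 0); first exact: measurable_cst.
  by apply/funext => x; rewrite /seqmax big_nil.
rewrite (_ : seqmax _ = (fun x => Num.max `|w i x| (seqmax s x))).
  have mi : measurable_on Omega (fun x => `|w i x|).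
    exact: (measurableT_comp (@normr_measurable R setT) (mw i)).
  exact: (measurable_maxr mi IH).
by apply/funext => x; rewrite seqmax_cons.
Qed.

Context (c : R).
Hypothesis Mc : forall s, (Xnorm Omega emb (seqmax s) <= c%:E)%E.

Lemma seqmax_integral_bound p : exists B : R, forall s,
  (\int[mu]_(x in om p) (seqmax s x)%:E <= B%:E)%E.
Proof.
have [D D0 hD] := bfs_P4 bfsX (om_measurable Omega p) (@om_Omega _ _ _ p)
  (om_finite Omega p).
exists (D * c) => s.
have Xs : Xmem Omega emb (seqmax s).
  by apply: Xnorm_lty_mem; rewrite (le_lt_trans (Mc s)) ?ltry.
rewrite (eq_integral (fun x : lebspace R n => (`|seqmax s x|)%:E)); last first.
  by move=> x _; rewrite ger0_norm ?seqmax_ge0.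
rewrite (le_trans (hD _ Xs))// EFinM lee_wpmul2l ?lee_fin ?(ltW D0)//.
apply: (@le_Xnorm _ _ _ _ _ bfsX _ _ c%:E _ (Mc s) (ltry _) _).2.
  apply: measurable_funM; first exact: seqmax_measurable.
  by apply: measurable_indic; exact: om_measurable.
apply: ae_onW => x _; rewrite normrM ger0_norm ?seqmax_ge0// ger0_norm//.
by rewrite ler_piMr ?seqmax_ge0// indicE; case: (_ \in _).
Qed.

(** On each [om p] the integrals of finite maxima are bounded, by (P4), so they have a supremum
    [m p]. Nested lists [S k] that nearly attain it leave no room for further functions: adjoining
    any list [t] raises the integral by at most 2^-k. Hence the maxima over [S k] converge in
    L^1_loc, and [t = [:: i]] shows that the limit dominates [|w i|]. *)
Lemma essential_supremum : exists g : T -> R, [/\ forall x, 0 <= g x,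
  (Xnorm Omega emb g <= c%:E)%E &
  forall i, ae_on Omega (fun x => `|w i x| <= g x)].
Proof.
have mO : measurable (Omega : set (lebspace R n)) by exact: open_lebn.
have mom p : measurable (om p : set (lebspace R n)) by exact: om_measurable.
have mE s p : measurable_fun (om p : set (lebspace R n)) (seqmax s).
  by apply: measurable_funS (seqmax_measurable s) => //; exact: om_Omega.
pose J p s := fine (\int[mu]_(x in om p) (seqmax s x)%:E).
have Jfin p s : (\int[mu]_(x in om p) (seqmax s x)%:E \is a fin_num)%E.
  have [B hB] := seqmax_integral_bound p.
  rewrite ge0_fin_numE; first by rewrite (le_lt_trans (hB s))// ltry.
  by apply: integral_ge0 => x _; rewrite lee_fin seqmax_ge0.
pose m p := sup (range (J p)).
have Jsup p : has_sup (range (J p)).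
  split; first by exists (J p [::]); exists [::].
  have [B hB] := seqmax_integral_bound p; exists B => _ [s _ <-].
  by rewrite -lee_fin fineK.
have Jm p s : J p s <= m p by apply: sup_upper_bound => //; exists s.
have [s_ hs] : {s_ : nat * nat -> seq I & forall pk, m pk.1 - dlen pk.2 < J pk.1 (s_ pk)}.
  apply: (@choice _ _ (fun pk s => m pk.1 - dlen pk.2 < J pk.1 s)) => -[p k] /=.
  have [_ [s _ <-] h] := sup_adherent (@dlen_gt0 R k) (Jsup p).
  by exists s.
(* Stage [k] adds the near-maximizers at precision 2^-k for all [p <= k], so that one sequence of
   lists serves every [om p]. *)
pose S := fix S k := (if k is k'.+1 then S k' else [::]) ++
  flatten [seq s_ (p, k) | p <- iota 0 k.+1].
have SS k : S k.+1 = S k ++ flatten [seq s_ (p, k.+1) | p <- iota 0 k.+2] by [].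
have S_prefix k k' : (k <= k')%N -> exists t, forall x,
    seqmax (S k') x = Num.max (seqmax (S k) x) (seqmax t x).
  move/subnK => <-; elim: (k' - k)%N => [|d [t ht]].
    by exists [::] => x; rewrite /seqmax big_nil max_l// seqmax_ge0.
  exists (t ++ flatten [seq s_ (p, (d + k).+1) | p <- iota 0 (d + k).+2]) => x.
  by rewrite addSn SS (seqmax_cat (S _)) (seqmax_cat t) ht maxA.
have S_large p k : (p <= k)%N -> forall x, seqmax (s_ (p, k)) x <= seqmax (S k) x.
  move=> pk x; have [t1 [t2 ->]] : exists t1 t2, S k = t1 ++ s_ (p, k) ++ t2.
    have [t ->] : exists t, S k = t ++ flatten [seq s_ (p, k) | p <- iota 0 k.+1].
      by case: (k) => [|k']; [exists [::]|exists (S k')].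
    have : p \in iota 0 k.+1 by rewrite mem_iota.
    case/splitPr => a b; exists (t ++ flatten [seq s_ (p, k) | p <- a]).
    exists (flatten [seq s_ (p, k) | p <- b]).
    by rewrite map_cat flatten_cat -catA.
  by rewrite !seqmax_cat !le_max lexx orbT.
(* The integrand is the amount by which the maximum over [t ++ S k] exceeds the maximum over [S k];
   the former has integral at most [m p], the latter more than [m p - dlen k]. *)
have tail p k t : (p <= k)%N -> (\int[mu]_(x in om p)
    (seqmax t x - Num.min (seqmax t x) (seqmax (S k) x))%:E <= (dlen k)%:E)%E.
  move=> pk.
  have mm : measurable_fun (om p : set (lebspace R n))
      (fun x => seqmax t x - Num.min (seqmax t x) (seqmax (S k) x)).
    exact: (measurable_funB (mE t p) (measurable_minr (mE t p) (mE (S k) p))).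
  have m0 x : 0 <= seqmax t x - Num.min (seqmax t x) (seqmax (S k) x).
    by rewrite subr_ge0 ge_min lexx.
  set b := (\int[mu]_(x in om p) _)%E.
  have abc : (\int[mu]_(x in om p) (seqmax (t ++ S k) x)%:E =
    b + \int[mu]_(x in om p) (seqmax (S k) x)%:E)%E.
    rewrite -ge0_integralD; first last.
    - exact/measurable_EFinP/mE.
    - by move=> x _; rewrite lee_fin seqmax_ge0.
    - exact/measurable_EFinP/mm.
    - by move=> x _; rewrite lee_fin.
    - exact: mom.
    - apply: eq_integral => x _; rewrite -EFinD; congr (_%:E).
      by rewrite seqmax_cat /Num.max /Num.min; case: ifPn; lra.
  have b0 : (0 <= b)%E by apply: integral_ge0 => x _; rewrite lee_fin.
  have bfin : b \is a fin_num.
    have := Jfin p (t ++ S k); rewrite abc !fin_numElt => /andP[_ h]; rewrite (lt_le_trans _ b0)//=.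
    by rewrite (le_lt_trans _ h)// leeDl// integral_ge0// => x _; rewrite lee_fin seqmax_ge0.
  have := congr1 fine abc; rewrite (fineD bfin (Jfin p (S k))).
  rewrite -/(J p (t ++ S k)) -/(J p (S k)) -(fineK bfin) lee_fin => e.
  have := Jm p (t ++ S k); have := hs (p, k) => /= h1.
  have h2 : J p (s_ (p, k)) <= J p (S k).
    rewrite -lee_fin (fineK (Jfin p _)) (fineK (Jfin p _)).
    apply: ge0_le_integral; first exact: mom.
    - by move=> x _; rewrite lee_fin seqmax_ge0.
    - exact/measurable_EFinP/mE.
    - exact/measurable_EFinP/mE.
    - by move=> x _; rewrite lee_fin S_large.
  lra.
have [||||g [sigma [mg ks gS _]]] := @L1loc_complete _ _ _ mu (@lebn_complete R n)
    Omega om (fun k => seqmax (S k)) mO mom (@om_Omega _ _ _).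
- exact: om_sub.
- exact: om_cover.
- by move=> k; exact: seqmax_measurable.
- move=> p e e0; have [N hN] := dlen_small e0; exists (maxn p N).
  move=> k k'; wlog kk' : k k' / (k <= k')%N => [H pk pk'|].
    have [|/ltnW] := leqP k k'; first by move=> ?; exact: H.
    move=> k'k; rewrite (eq_integral (fun x : lebspace R n =>
        (`|seqmax (S k') x - seqmax (S k) x|)%:E)).
      exact: H.
    by move=> x _; rewrite distrC.
  rewrite !geq_max => /andP[pk Nk] _; have [t ht] := S_prefix _ _ kk'.
  rewrite (eq_integral (fun x : lebspace R n =>
      (seqmax t x - Num.min (seqmax t x) (seqmax (S k) x))%:E)).
    by rewrite (le_trans (tail _ _ _ pk))// lee_fin hN.
  move=> x _; congr (_%:E); rewrite ht distrC ger0_norm ?subr_ge0 ?le_max ?lexx//.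
  by rewrite /Num.max /Num.min; case: ltgtP; lra.
(* The limit [g] is nonnegative only a.e. on [Omega]; the absolute value makes it so everywhere. *)
exists (fun x => `|g x|); split=> //.
- apply: (@Xnorm_fatou _ _ _ _ _ bfsX (fun k => seqmax (S (sigma k)))) => //.
  + by move=> k; exact: seqmax_measurable.
  + by apply: measurableT_comp.
  + by move=> k x _; exact: seqmax_ge0.
  + apply: ae_onS gS => x _ /cvg_norm.
    by under eq_fun do rewrite ger0_norm ?seqmax_ge0//.
move=> i.
pose b k x := seqmax [:: i] x - Num.min (seqmax [:: i] x) (seqmax (S k) x).
have bcvg : ae_on Omega (fun x => b k x @[k --> \oo] --> 0).
  have bp p : {ae mu, forall x, om p x -> cvgn (series (b ^~ x))}.
    apply: (@geometric_integrals_summable _ _ _ mu (om p) b p (mom p)).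
    - by move=> k; exact: (measurable_funB (mE _ p) (measurable_minr (mE _ p) (mE (S k) p))).
    - by move=> k x _; rewrite subr_ge0 ge_min lexx.
    - by move=> k pk; exact: tail.
  have := ae_foralln bp; apply: filterS => x h Ox.
  by have [p _ /h] := om_cover openOmega Ox; exact: cvg_series_cvg_0.
apply: ae_onS2 bcvg gS => x Ox bx gx.
apply/ler_addgt0Pr => e e0.
have e20 : 0 < e / 2 by rewrite divr_gt0.
move/cvgrPdist_lt/(_ _ e20): bx => [N1 _ h1].
move/cvgrPdist_lt/(_ _ e20): gx => [N2 _ h2].
pose k := maxn N1 N2.
have := h2 k (leq_maxr _ _); have := h1 (sigma k) (leq_trans (leq_maxl _ _) (ks k)).
rewrite /= sub0r normrN /b seqmax_cons /seqmax big_nil max_l//.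
rewrite -/(seqmax (S _) x); set y := seqmax _ x.
have := ler_norm (g x); rewrite ltr_norml ltr_norml /Num.min; case: ifPn.
  by lra.
by lra.
Qed.

End essential_supremum.

(** * Weak derivatives as limits of difference quotients *)

Section test_functions.
Context (R : realType) (n : nat) (Omega : set 'rV[R]_n.+1).
Notation T := 'rV[R]_n.+1.
Context (phi : T -> R) (j : 'I_n.+1).
Hypothesis tphi : test_function Omega phi.
Local Notation K := (closure [set x | phi x != 0]).
Local Notation e := (stdvec j : T).

Lemma test_derivable x : derivable phi x e.
Proof. by case: tphi => /(_ 1%N) [_ /(_ j) [h _]] _ _; exact: h. Qed.

Lemma test_continuous : continuous phi.
Proof. by case: tphi => /(_ 0%N). Qed.

Lemma test_derive_continuous : continuous ('D_e phi).
Proof. by case: tphi => /(_ 1%N) [_ /(_ j) [_ h]] _ _; exact: h. Qed.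

Lemma test_notin x : ~ K x -> phi x = 0.
Proof.
move=> Kx; apply/eqP; apply: contrapT => /negP h.
by apply: Kx; exact: subset_closure.
Qed.

Lemma test_derive_notin x : ~ K x -> 'D_e phi x = 0.
Proof.
move=> Kx; have oK : open (~` K) by rewrite openC; exact: closed_closure.
rewrite -(@derive_cst R T R 0 e x); apply: near_eq_derive.
have : nbhs x (~` K) by exact: open_nbhs_nbhs.
by apply: filterS => y Ky; exact: test_notin.
Qed.

Lemma bounded_on_support (psi : T -> R) : continuous psi ->
  (forall x, ~ K x -> psi x = 0) -> exists2 B, 0 <= B & forall x, `|psi x| <= B.
Proof.
case: tphi => _ cK _ cpsi psi0.
have /compact_bounded [M [_ hM]] : compact (psi @` K).
  by apply: continuous_compact => //; exact: continuous_subspaceT.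
exists (`|M| + 1) => [|x]; first by rewrite addr_ge0.
have [Kx|/psi0 ->] := pselect (K x); last by rewrite normr0 addr_ge0.
apply: hM; last by exists x.
by rewrite (le_lt_trans (ler_norm _))// ltrDl.
Qed.

Lemma test_line_derive x t :
  is_derive t (1 : R) (fun s : R => phi (x + s *: e)) ('D_e phi (x + t *: e)).
Proof.
have E : (fun h : R => h^-1 *: (phi (x + (h *: (1 : R) + t) *: e) - phi (x + t *: e))) =
    (fun h => h^-1 *: (phi (h *: e + (x + t *: e)) - phi (x + t *: e))).
  apply/funext => h; congr (_ *: (phi _ - _)).
  by rewrite scaler1 scalerDl addrCA.
by split; rewrite /derivable /derive /= E//; exact: test_derivable.
Qed.

Lemma test_difference_le B x h : (forall y, `|'D_e phi y| <= B) ->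
  `|phi (x - h *: e) - phi x| <= B * `|h|.
Proof.
move=> hB; wlog h0 : x h / 0 <= h => [H|].
  have [/H//|h0] := leP 0 h.
  have := H (x - h *: e) (- h); rewrite scaleNr opprK subrK distrC normrN.
  by apply; rewrite oppr_ge0 ltW.
have [] := @MVT_segment R (fun s => phi (x - h *: e + s *: e))
  (fun s => 'D_e phi (x - h *: e + s *: e)) 0 h h0.
- by move=> s _; exact: test_line_derive.
- apply: continuous_subspaceT => s; apply: differentiable_continuous.
  by apply/derivable1_diffP; case: (test_line_derive (x - h *: e) s).
move=> s _; rewrite scale0r addr0 subrK subr0 distrC => ->.
by rewrite normrM ler_wpM2r.
Qed.

(** The adjoint of the forward difference quotient: a backward difference with reversed sign, hence
    the limit [- 'D_e phi]. *)
Definition test_quotient k x : R := (dlen k)^-1 * (phi (x - dlen k *: e) - phi x).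

Lemma test_quotient_cvg x : test_quotient k x @[k --> \oo] --> - 'D_e phi x.
Proof.
have D : h^-1 *: ((phi \o shift x) (h *: e) - phi x)
    @[h --> 0^'] --> ('D_e phi x : R) := @test_derivable x.
have dl : (forall k, - dlen k != 0 :> R) /\ (- dlen k @[k --> \oo] --> (0 : R)).
  split=> [k|]; first by rewrite oppr_eq0 gt_eqF// dlen_gt0.
  rewrite -oppr0; apply: cvgN; apply/cvgrPdist_le => r r0.
  have [N hN] := dlen_small r0; exists N => // k /= Nk.
  by rewrite sub0r normrN gtr0_norm ?hN// dlen_gt0.
have /cvgN := (cvgr_dnbhsP _ _ _).1 D _ dl.
rewrite (_ : (- _) = test_quotient ^~ x)//; apply/funext => k.
rewrite /test_quotient /= -[LHS]/(- (_ *: _)) invrN scaleNr opprK scaleNr.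
by rewrite [X in phi X]addrC.
Qed.

End test_functions.

Section weak_derivative.
Context (R : realType) (n : nat) (Omega : set 'rV[R]_n.+1).
Hypothesis openOmega : open Omega.
Notation T := 'rV[R]_n.+1.
Notation mu := (@lebn R n).
Notation LS := (lebspace R n).
Local Notation om := (om Omega).
Context (j : 'I_n.+1) (f w : T -> R).
Hypothesis mf : measurable_on Omega f.
Hypothesis lf : forall p, (\int[mu]_(x in om p) (`|f x|)%:E < +oo)%E.
Hypothesis lw : L1loc Omega w.

Definition zext x : R := f x * \1_Omega x.

Definition diff_quotient k x : R :=
  (dlen k)^-1 * (zext (x + dlen k *: stdvec j) - zext x).

Lemma measurable_zext : measurable_fun setT (zext : LS -> R).
Proof.
have mO : measurable (Omega : set LS) by exact: open_lebn.
rewrite (_ : zext = f \_ Omega); first exact/(measurable_restrictT _ mO).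
by apply/funext => x; rewrite /zext /patch indicE; case: ifPn; rewrite ?mulr1 ?mulr0.
Qed.

Lemma measurable_diff_quotient k : measurable_fun setT (diff_quotient k : LS -> R).
Proof.
exact: (measurable_funM (measurable_cst _) (measurable_funB
  (measurableT_comp measurable_zext (measurable_shift _)) measurable_zext)).
Qed.

Lemma integrable_zext_mul p (psi : T -> R) B : measurable_fun setT (psi : LS -> R) ->
  (forall x, `|psi x| <= B) -> (forall x, ~ om p x -> psi x = 0) ->
  mu.-integrable setT (fun x => (zext x * psi x)%:E).
Proof.
move=> mpsi psiB psi0.
have mom : measurable (om p : set LS) by exact: om_measurable.
rewrite (_ : (fun x => _) = (fun x : LS => (zext x * psi x)%:E) \_ (om p)); last first.
  apply/funext => x; rewrite /patch; case: ifPn => //.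
  by rewrite notin_setE => /psi0 ->; rewrite mulr0.
rewrite -integrable_mkcond//.
have iz : mu.-integrable (om p : set LS) (EFin \o (zext : LS -> R)).
  apply/integrableP; split.
    by apply/measurable_EFinP; apply: measurable_funTS; exact: measurable_zext.
  rewrite (eq_integral (fun x : LS => (`|f x|)%:E))// => x /set_mem xp /=.
  by rewrite /zext indicE mem_set ?mulr1//; exact: om_Omega xp.
have bpsi : [bounded psi x | x in (om p : set LS)].
  by exists B; split; [rewrite num_real|move=> M BM x _ /=; rewrite (le_trans (psiB x))// ltW].
have := integrableMl mom iz (measurable_funTS mpsi) bpsi.
by apply: eq_integrable => // x _; rewrite /= EFinM.
Qed.

Hypothesis dqw : forall p r, 0 < r -> exists N, forall k, (N <= k)%N ->
  (\int[mu]_(x in om p) (`|diff_quotient k x - w x|)%:E <= r%:E)%E.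

(** Translation invariance gives a discrete integration by parts, [parts]. On one side the quotients
    of [phi] are bounded by [D] and supported in [om p.+1], so dominated convergence applies; on the
    other, L^1 convergence on the compact support is tested against the bounded [phi]. *)
Lemma weak_partial_of_diff_quotient : weak_partial Omega j f w.
Proof.
split=> // phi tphi; set K := closure [set x | phi x != 0].
have [_ cK KO] := tphi.
have [p Kp] := compact_om openOmega cK KO.
have cphi := test_continuous tphi.
have [B B0 hB] := bounded_on_support tphi cphi
  (@test_notin _ _ phi).
have [D D0 hD] := bounded_on_support tphi (@test_derive_continuous _ _ _ _ j tphi)
  (@test_derive_notin _ _ phi j).
set e := stdvec j.
have mphi : measurable_fun setT (phi : LS -> R) by exact: continuous_lebn.
have mD : measurable_fun setT ('D_e phi : LS -> R).
  by apply: continuous_lebn => //; exact: test_derive_continuous tphi.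
have mom q : measurable (om q : set LS) by exact: om_measurable.
have mK : measurable (K : set LS) by apply: closed_lebn; exact: closed_closure.
(* Steps of at most 2^-(p+1) move the support of [phi], contained in [om p], no further than
   [om p.+1]. *)
pose tq k := test_quotient phi j (k + p.+1).
have mphis h : measurable_fun setT ((fun x => phi (x + h)) : LS -> R).
  exact: (measurableT_comp mphi (measurable_shift h)).
have mtq k : measurable_fun setT (tq k : LS -> R).
  exact: (measurable_funM (measurable_cst _) (measurable_funB (mphis _) mphi)).
have small k : `|dlen (k + p.+1) *: e : T| <= dlen p.+1.
  rewrite norm_stdvec gtr0_norm ?dlen_gt0// dlenD ger_pMl ?dlen_gt0//.
  by rewrite invf_le1 ?exprn_gt0// exprn_ege1// ler1n.
have phis0 k x : ~ om p.+1 x -> phi (x - dlen (k + p.+1) *: e) = 0.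
  move=> xp; apply: test_notin => Kx; apply: xp.
  by rewrite -[x](subrK (dlen (k + p.+1) *: e)); apply: om_shift (small k); exact: Kp.
have phi0 x : ~ om p.+1 x -> phi x = 0.
  by move=> xp; apply: test_notin => /Kp /om_sub.
have tqD k x : `|tq k x| <= D.
  rewrite /tq /test_quotient normrM gtr0_norm ?invr_gt0 ?dlen_gt0//.
  rewrite ler_pdivrMl ?dlen_gt0// mulrC.
  by rewrite (le_trans (test_difference_le tphi _ _ hD))// gtr0_norm// dlen_gt0.
have tq0 k x : ~ om p.+1 x -> tq k x = 0.
  by move=> xp; rewrite /tq /test_quotient phis0// phi0// subrr mulr0.
have i1 k : mu.-integrable setT (fun x => (zext x * phi (x - dlen (k + p.+1) *: e))%:E).
  by apply: (@integrable_zext_mul p.+1 _ B) => //; exact: phis0.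
have i2 : mu.-integrable setT (fun x => (zext x * phi x)%:E).
  exact: (@integrable_zext_mul p.+1 _ B).
have i3 k : mu.-integrable setT (fun x => (zext (x + dlen (k + p.+1) *: e) * phi x)%:E).
  have m3 : measurable_fun setT (fun x : LS => (zext (x + dlen (k + p.+1) *: e) * phi x)%:E).
    apply/measurable_EFinP.
    exact: (measurable_funM (measurableT_comp measurable_zext (measurable_shift _)) mphi).
  apply/integrableP; split=> //.
  have /integrableP[m1 h1] := i1 k; apply: le_lt_trans h1.
  have mabs := measurableT_comp (@abse_measurable R setT) m1.
  rewrite [leRHS](ge0_integral_shift (dlen (k + p.+1) *: e) measurableT mabs)//
    => [|x _]; last exact: abse_ge0.
  rewrite preimage_setT le_eqVlt; apply/orP; left; apply/eqP.
  by apply: eq_integral => x _; rewrite /= /translate addrK.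
have shiftE k : \int[mu]_x (zext x * phi (x - dlen (k + p.+1) *: e)) =
    \int[mu]_x (zext (x + dlen (k + p.+1) *: e) * phi x).
  congr fine; have /integrableP[m1 _] := i1 k.
  rewrite (integral_shift (dlen (k + p.+1) *: e) m1).
  by apply: eq_integral => x _; rewrite /= /translate addrK.
have parts k : \int[mu]_x (zext x * tq k x) =
    \int[mu]_x (diff_quotient (k + p.+1) x * phi x).
  rewrite (@eq_Rintegral _ _ _ mu setT (fun x => (dlen (k + p.+1))^-1 *
      (zext x * phi (x - dlen (k + p.+1) *: e) - zext x * phi x))); last first.
    by move=> x _; rewrite /tq /test_quotient; ring.
  rewrite [RHS](@eq_Rintegral _ _ _ mu setT (fun x => (dlen (k + p.+1))^-1 *
      (zext (x + dlen (k + p.+1) *: e) * phi x - zext x * phi x))); last first.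
    by move=> x _; rewrite /diff_quotient; ring.
  rewrite !RintegralZl//; [|by have := integrableB measurableT (i3 k) i2; apply: eq_integrable
    |by have := integrableB measurableT (i1 k) i2; apply: eq_integrable].
  congr (_ * _); rewrite (RintegralB measurableT (i1 k) i2) (RintegralB measurableT (i3 k) i2).
  by congr (_ - _); exact: shiftE.
have lim1 : (\int[mu]_x (zext x * tq m x)) @[m --> \oo] -->
    - \int[mu]_x (zext x * 'D_e phi x).
  have DD0 x : ~ om p.+1 x -> `|'D_e phi x| = 0.
    move=> xp; rewrite test_derive_notin ?normr0//.
    by move=> /Kp /om_sub.
  have iD : mu.-integrable setT (fun x => (zext x * 'D_e phi x)%:E).
    apply: (@integrable_zext_mul p.+1 _ D) => // x xp.
    by have /eqP := DD0 x xp; rewrite normr_eq0 => /eqP.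
  have mND : measurable_fun setT (fun x : LS => (zext x * - 'D_e phi x)%:E).
    exact/measurable_EFinP/(measurable_funM measurable_zext (measurable_funN mD)).
  have mf_ m : measurable_fun setT (fun x : LS => (zext x * tq m x)%:E).
    exact/measurable_EFinP/(measurable_funM measurable_zext (mtq m)).
  have idom : mu.-integrable setT (fun x : LS => (`|zext x * (D * \1_(om p.+1) x)|)%:E).
    apply: (@integrable_norm _ _ _ mu setT (fun x : LS => zext x * (D * \1_(om p.+1) x))).
    apply: (@integrable_zext_mul p.+1 _ D).
    - exact: (measurable_funM (measurable_cst _) (measurable_indic (mom _))).
    - move=> x; rewrite normrM ger0_norm// ler_piMr// indicE.
      by case: (_ \in _); rewrite /= ?normr1 ?normr0.
    - by move=> x xp; rewrite indicE memNset ?mulr0.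
  have := @dominated_convergence _ _ _ mu setT measurableT
    (fun m x => (zext x * tq m x)%:E) (fun x => (zext x * - 'D_e phi x)%:E) _ mf_ mND _ idom _.
  case.
  - apply: aeW => x _; apply: cvg_EFin; first exact: nearW.
    apply: cvgM; first exact: cvg_cst.
    by have := @test_quotient_cvg _ _ _ _ j tphi x; rewrite -(cvg_shiftn p.+1).
  - apply: aeW => x m _; rewrite lee_fin (normrM (zext x)) [leRHS](normrM (zext x)).
    rewrite ler_wpM2l// (normrM D) (ger0_norm D0).
    have [xp|xp] := pselect (om p.+1 x).
      by rewrite indicE mem_set// normr1 mulr1 tqD.
    by rewrite tq0// normr0 mulr_ge0.
  move=> iND _; rewrite -(fineK (integrable_fin_num measurableT iND)).
  move=> /fine_cvg cv.
  rewrite -[X in _ --> X]mulN1r -RintegralZl//.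
  rewrite (_ : \int[mu]_x (-1 * _) = \int[mu]_x (zext x * - 'D_e phi x)).
    exact: cv.
  by apply: eq_Rintegral => x _; rewrite mulN1r mulrN.
have lim2 : (\int[mu]_x (diff_quotient (m + p.+1) x * phi x)) @[m --> \oo] -->
    \int[mu]_(x in K) (w x * phi x).
  have iw : mu.-integrable (K : set LS) (fun x => (w x * phi x)%:E).
    have bphi : [bounded phi x | x in (K : set LS)].
      by exists B; split; [rewrite num_real|move=> M BM x _ /=; rewrite (le_trans (hB x))// ltW].
    have := integrableMl mK (lw.2 _ cK KO) (measurable_funTS mphi) bphi.
    by apply: eq_integrable => // x _; rewrite /= EFinM.
  have iq m : mu.-integrable (setT : set LS)
      (fun x => (diff_quotient (m + p.+1) x * phi x)%:E).
    have := integrableZl measurableT (dlen (m + p.+1))^-1 (integrableB measurableT (i3 m) i2).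
    apply: eq_integrable => // x _; rewrite /= -EFinB -EFinM; congr (_%:E).
    by rewrite /diff_quotient -mulrBl mulrA.
  have iqK m : mu.-integrable (K : set LS)
      (fun x => (diff_quotient (m + p.+1) x * phi x)%:E).
    exact: integrableS (iq m).
  have qK m : \int[mu]_x (diff_quotient (m + p.+1) x * phi x) =
      \int[mu]_(x in K) (diff_quotient (m + p.+1) x * phi x).
    rewrite [RHS]Rintegral_mkcond; apply: eq_Rintegral => x _.
    rewrite /patch; case: ifPn => // xK.
    by rewrite (@test_notin _ _ phi x) ?mulr0//; move: xK; rewrite notin_setE.
  apply/cvgrPdist_le => r r0.
  have r1 : 0 < r / (B + 1) by rewrite divr_gt0// ltr_wpDl.
  have [N hN] := dqw p r1; exists N => // m /= Nm.
  rewrite qK distrC -(RintegralB mK (iqK m) iw).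
  have iB : mu.-integrable (K : set LS)
      (fun x => (diff_quotient (m + p.+1) x * phi x - w x * phi x)%:E).
    by have := integrableB mK (iqK m) iw; apply: eq_integrable => // x _; rewrite /= EFinB.
  rewrite (le_trans (le_normr_Rintegral mK iB))//.
  have mKw : measurable_fun (K : set LS) (fun x => diff_quotient (m + p.+1) x - w x).
    apply: measurable_funB; first exact/measurable_funTS/measurable_diff_quotient.
    apply: measurable_funS lw.1 => //; exact: open_lebn.
  have mow : measurable_fun (om p : set LS) (fun x => diff_quotient (m + p.+1) x - w x).
    apply: measurable_funB; first exact/measurable_funTS/measurable_diff_quotient.
    apply: measurable_funS lw.1; [exact: open_lebn|exact: om_Omega].
  have nn := measurableT_comp (@normr_measurable R setT).
  rewrite -lee_fin fineK; last first.
    apply: integrable_fin_num => //.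
    exact: (@integrable_norm _ _ _ mu _ (fun x : LS => _) iB).
  apply: (@le_trans _ _ (\int[mu]_(x in K)
    ((B + 1)%:E * (`|diff_quotient (m + p.+1) x - w x|)%:E))%E).
    apply: ge0_le_integral; first exact: mK.
    - by move=> x _; exact: normr_ge0.
    - by move: iB => /integrable_norm /integrableP[].
    - apply/measurable_EFinP.
      exact: (measurable_funM (measurable_cst _) (nn _ _ _ _ mKw)).
    - move=> x _; rewrite -EFinM lee_fin -mulrBl normrM mulrC ler_wpM2r//.
      by rewrite (le_trans (hB x))// lerDl.
  rewrite ge0_integralZl//; [|exact/measurable_EFinP/(nn _ _ _ _ mKw)|by rewrite lee_fin addr_ge0].
  apply: (@le_trans _ _ ((B + 1)%:E * (r / (B + 1))%:E)%E).
    rewrite lee_wpmul2l ?lee_fin ?addr_ge0//.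
    rewrite (le_trans _ (hN (m + p.+1)%N (leq_trans Nm (leq_addr _ _))))//.
    apply: ge0_subset_integral; [exact: mK|exact: mom| |by []|exact: Kp].
    exact/measurable_EFinP/(nn _ _ _ _ mow).
  by rewrite -EFinM lee_fin mulrC divfK// gt_eqF// ltr_wpDl.
have E1 : \int[mu]_(x in Omega) (f x * 'D_e phi x) =
    \int[mu]_x (zext x * 'D_e phi x).
  rewrite Rintegral_mkcond; apply: eq_Rintegral => x _.
  rewrite /patch /zext indicE; case: ifPn => _; first by rewrite mulr1.
  by rewrite mulr0 mul0r.
have E2 : \int[mu]_(x in Omega) (w x * phi x) = \int[mu]_(x in K) (w x * phi x).
  rewrite Rintegral_mkcond [RHS]Rintegral_mkcond; apply: eq_Rintegral => x _.
  rewrite /patch; case: ifPn => xO; case: ifPn => xK //.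
    by rewrite (@test_notin _ _ phi x) ?mulr0//; move: xK; rewrite notin_setE.
  by move: xO; rewrite notin_setE => -[]; apply: KO; exact: set_mem.
suff h : \int[mu]_x (zext x * 'D_e phi x) = - \int[mu]_(x in K) (w x * phi x).
  exact: (etrans E1 (etrans h (esym (congr1 -%R E2)))).
move: lim1; under eq_fun do rewrite parts.
move=> /(cvg_lim (@norm_hausdorff _ R)) l1.
by rewrite -[LHS]opprK -l1 (cvg_lim (@norm_hausdorff _ R) lim2).
Qed.

End weak_derivative.

(** * The difference quotients of the components of u *)

Section difference_quotients.
Context (R : realType) (n : nat) (Omega : set 'rV[R]_n.+1).
Context (V X : completeNormedModType R) (emb : X -> 'rV[R]_n.+1 -> R).
Hypothesis openOmega : open Omega.
Hypothesis bfsX : banach_function_space Omega emb.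
Hypothesis rnpX : radon_nikodym_property X.
Notation T := 'rV[R]_n.+1.
Notation mu := (@lebn R n).
Notation LS := (lebspace R n).
Local Notation om := (om Omega).
Local Notation Xnorm := (Xnorm Omega emb).
Local Notation Xmem := (Xmem Omega emb).
Context (u : T -> V) (C : R) (j : 'I_n.+1).
Hypothesis Xu : XVmem Omega emb u.
Hypothesis C_ge0 : 0 <= C.
Local Notation e := (stdvec j : T).
Hypothesis uC : forall (omega : set T) (s t : R),
  compactly_contained omega Omega ->
  ((Num.max `|t| `|s|)%:E < set_dist omega (boundary Omega))%E ->
  (XVnorm_on Omega emb omega
     (fun x => translation Omega (t *: e) u x - translation Omega (s *: e) u x)%R
   <= (C * `|t - s|)%:E)%E.
Implicit Type l : {linear V -> R^o}.

Lemma dual_unit_ball_le l v : dual_unit_ball l -> `|l v| <= `|v|.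
Proof.
move=> [_ l1]; have [->|v0] := eqVneq v 0; first by rewrite linear0 !normr0.
have nv : 0 < `|v| by rewrite normr_gt0.
have : (`|l (`|v|^-1 *: v)|%:E <= 1)%E.
  apply: le_trans l1; apply: ereal_sup_ubound; exists (`|v|^-1 *: v) => //=.
  by rewrite normrZ ger0_norm ?invr_ge0// mulVf// gt_eqF.
by rewrite lee_fin linearZ /= normrM ger0_norm ?invr_ge0// ler_pdivrMl// mulr1.
Qed.

Lemma linear_comp_measurable l : dual_unit_ball l ->
  measurable_on Omega (l \o u).
Proof.
move=> [cl _]; have [[s [ss su]] _] := Xu.
have mO : measurable (Omega : set LS) by exact: open_lebn.
apply: (@ae_cvg_measurable _ _ _ _ (@lebn_complete R n) _
  (fun k => (l : V -> R) \o s k)) => //.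
- by move=> k; apply: measurable_funTS; exact: simple_function_measurable.
- by apply: filterS su => x h /h; exact: (continuous_cvg _ (cl _)).
Qed.

Lemma om_translation p x h : om p x -> `|h| <= dlen p ->
  translation Omega h u x = u (x + h).
Proof.
by move=> xp hp; rewrite /translation mem_set//; exact: om_in xp hp.
Qed.

Lemma translation_osc p s t : `|s| < dlen p -> `|t| < dlen p ->
  (Xnorm (fun x => `|\1_(om p) x *: (translation Omega (t *: e) u x
     - translation Omega (s *: e) u x)|)%R <= (C * `|t - s|)%:E)%E.
Proof.
move=> sp tp; apply: uC; first exact: om_compactly_contained.
by apply: lt_le_trans (om_set_dist openOmega p); rewrite lte_fin gt_max tp sp.
Qed.

Lemma zext_om p x h l : om p x -> `|h| <= dlen p ->
  zext Omega (l \o u) (x + h) = l (u (x + h)).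
Proof.
by move=> xp hp; rewrite /zext indicE mem_set ?mulr1//; exact: om_in xp hp.
Qed.

Lemma zext_osc l p s t : dual_unit_ball l -> `|s| < dlen p -> `|t| < dlen p ->
  let f x := \1_(om p) x *
    (zext Omega (l \o u) (x + t *: e) - zext Omega (l \o u) (x + s *: e)) in
  Xmem f /\ (Xnorm f <= (C * `|t - s|)%:E)%E.
Proof.
move=> ll sp tp f.
have mz := measurable_zext openOmega (linear_comp_measurable ll).
have mom : measurable (om p : set LS) by exact: om_measurable.
apply: (le_Xnorm bfsX _ (translation_osc sp tp) (ltry _)).
  apply: measurable_funTS; apply: (measurable_funM (measurable_indic mom)).
  exact: (measurable_funB (measurableT_comp mz (measurable_shift _))
    (measurableT_comp mz (measurable_shift _))).
apply: ae_onW => x _; rewrite /f /= normrM normrZ.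
have [xp|xp] := pselect (om p x); last first.
  by rewrite indicE memNset// normr0 !mul0r.
rewrite ler_wpM2l// !(om_translation xp) ?(zext_om _ xp) ?norm_stdvec ?(ltW sp) ?(ltW tp)//.
by rewrite -linearB; exact: dual_unit_ball_le.
Qed.

(** The path [F] lives on [om p.+1], with its parameter rescaled to [0, 2] by the factor [d]. Its
    quotient at [t] on scale 2^-m is [d] times the quotient of the component at scale 2^-(m+p+3),
    shifted by [d * t]. The shift depends on the scales but is harmless: translating [om p] back
    keeps it inside [om p.+1]. *)
Lemma diff_quotient_cauchy l p r : dual_unit_ball l -> 0 < r ->
  exists N, forall k k', (N <= k)%N -> (N <= k')%N ->
    (\int[mu]_(x in om p) (`|diff_quotient Omega j (l \o u) k x
       - diff_quotient Omega j (l \o u) k' x|)%:E <= r%:E)%E.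
Proof.
move=> ll r0; set z := zext Omega (l \o u); set dq := diff_quotient Omega j (l \o u).
have mf := linear_comp_measurable ll.
have mz := measurable_zext openOmega mf.
have mdq k : measurable_fun setT (dq k : LS -> R) by exact: measurable_diff_quotient.
have mom q : measurable (om q : set LS) by exact: om_measurable.
(* With [p.+3] the largest shift [2 * d] is strictly below the margin [4 * d] of [om p.+1]. *)
pose d : R := dlen p.+3.
have d0 : 0 < d by exact: dlen_gt0.
have dS q : dlen q.+1 = dlen q / 2 :> R by rewrite /dlen exprS invfM mulrC.
have dp : dlen p.+1 = 4 * d :> R by rewrite /d !dS; lra.
have dt (t : R) : 0 <= t <= 2 -> `|d * t| < dlen p.+1.
  move=> /andP[t0 t2]; rewrite ger0_norm ?mulr_ge0 ?(ltW d0)// dp mulrC.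
  by rewrite ltr_pM2r//; lra.
have z0 : `|0 : R| < dlen p.+1 by rewrite normr0 dlen_gt0.
have [F hF] : {F : R -> X & forall t, 0 <= t <= 2 -> ae_on Omega (fun x =>
    emb (F t) x = \1_(om p.+1) x * (z (x + (d * t) *: e) - z (x + 0 *: e)))}.
  apply: (@choice _ _ (fun t phi => 0 <= t <= 2 -> ae_on Omega (fun x =>
    emb phi x = \1_(om p.+1) x * (z (x + (d * t) *: e) - z (x + 0 *: e))))) => t.
  have [t02|nt] := pselect (is_true (0 <= t <= 2)); last by exists 0.
  by have [[phi h] _] := zext_osc ll z0 (dt t t02); exists phi.
have FB s t : 0 <= s <= 2 -> 0 <= t <= 2 -> ae_on Omega (fun x =>
    emb (F t - F s) x = \1_(om p.+1) x * (z (x + (d * t) *: e) - z (x + (d * s) *: e))).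
  move=> s02 t02; have := ae_on_and (hF s s02) (hF t t02).
  by apply: ae_onS2 (embB bfsX (F t) (F s)) => x _ -> [-> ->]; ring.
have FL s t : 0 <= s <= 2 -> 0 <= t <= 2 -> `|F t - F s| <= (C * d) * `|t - s|.
  move=> s02 t02; rewrite -lee_fin -(XnormE bfsX (FB s t s02 t02)).
  have [_ h] := zext_osc ll (dt s s02) (dt t t02).
  rewrite (le_trans h)// lee_fin -mulrBr; by rewrite normrM (ger0_norm (ltW d0)) mulrA.
have [D D0 hD] := bfs_P4 bfsX (mom p.+1) (@om_Omega _ _ _ p.+1) (om_finite Omega p.+1).
(* Passing to L^1 by (P4) costs the factor [D], and undoing the rescaling divides by [d]. *)
have ep0 : 0 < r * d / D by rewrite divr_gt0// mulr_gt0.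
have [N hN] := radon_nikodym_dyadic_cauchy rnpX
  (mulr_ge0 C_ge0 (ltW d0)) FL ep0.
exists (N + p.+3)%N => k k'; wlog kk' : k k' / (k <= k')%N => [H Nk Nk'|].
  have [|/ltnW k'k] := leqP k k'; first by move=> ?; exact: H.
  rewrite (eq_integral (fun x : LS => (`|dq k' x - dq k x|)%:E)); first exact: H.
  by move=> x _; rewrite distrC.
move=> Nk _; have pk : (p.+3 <= k)%N by rewrite (leq_trans _ Nk)// leq_addl.
pose m := (k - p.+3)%N; pose m' := (k' - p.+3)%N.
have mE : k = (m + p.+3)%N by rewrite subnK.
have mE' : k' = (m' + p.+3)%N by rewrite subnK// (leq_trans pk).
have Nm : (N <= m)%N by rewrite -(leq_add2r p.+3) -mE.
have mm' : (m <= m')%N by rewrite leq_sub2r.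
have [t [t0 t1 ht]] := hN m m' Nm mm'.
set Z := _ *: _ - _ in ht.
pose s := d * t.
have dl1 q : dlen q <= 1 :> R by rewrite invf_le1 ?exprn_gt0// exprn_ege1// ler1n.
have t02 : 0 <= t <= 2 by apply/andP; split; lra.
have tq q : 0 <= t + dlen q <= 2.
  by apply/andP; have := dl1 q; have := @dlen_gt0 R q; split; lra.
have ZE : ae_on Omega (fun x =>
    emb Z x = \1_(om p.+1) x * (d * (dq k (x + s *: e) - dq k' (x + s *: e)))).
  have a1 := ae_on_and (embZ bfsX (dlen m)^-1 (F (t + dlen m) - F t)) (FB t _ t02 (tq m)).
  have a2 := ae_on_and (embZ bfsX (dlen m')^-1 (F (t + dlen m') - F t)) (FB t _ t02 (tq m')).
  have := embB bfsX ((dlen m)^-1 *: (F (t + dlen m) - F t))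
    ((dlen m')^-1 *: (F (t + dlen m') - F t)).
  apply: ae_onS2 (ae_on_and a1 a2) => x _ [[-> ->] [-> ->]] ->.
  have step q x' : d * dq (q + p.+3)%N (x' + s *: e) =
      (dlen q)^-1 * (z (x' + (d * (t + dlen q)) *: e) - z (x' + (d * t) *: e)).
    rewrite /dq /diff_quotient dlenD -/d -addrA -scalerDl -/z.
    rewrite (_ : s + dlen q * d = d * (t + dlen q)); last by rewrite /s; ring.
    have dq0 : dlen q != 0 :> R by rewrite gt_eqF// dlen_gt0.
    have dn0 : d != 0 by rewrite gt_eqF.
    by rewrite -/s mulrA; congr (_ * _); field; rewrite dn0 dq0.
  by rewrite mE mE' [d * (_ - _)]mulrBr !step; ring.
have Zn : (\int[mu]_(x in om p.+1) (`|emb Z x|)%:E <= (r * d)%:E)%E.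
  have XZ : Xmem (emb Z) by exists Z; exact: ae_onW.
  rewrite (le_trans (hD _ XZ))//.
  rewrite (@XnormE _ _ _ _ _ bfsX Z); last first.
    by apply: ae_onS ZE => x _ ->; rewrite indicE; case: (_ \in _); rewrite ?mul0r ?mul1r ?mulr1.
  rewrite -EFinM lee_fin (le_trans (ler_wpM2l (ltW D0) ht))//.
  by rewrite mulrC divfK// gt_eqF.
have mg : measurable_fun setT (fun x : LS => (`|dq k x - dq k' x|)%:E).
  apply/measurable_EFinP; exact: (measurableT_comp (@normr_measurable R setT)
    (measurable_funB (mdq k) (mdq k'))).
rewrite (ge0_integral_shift (s *: e) (mom p) (measurable_funTS mg))//.
have sub : translate (s *: e) @^-1` om p `<=` om p.+1.
  move=> x xp; rewrite -[x](addrK (s *: e)); apply: om_shift => //.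
  by rewrite normrN norm_stdvec ltW// dt.
have mgs := measurableT_comp mg (measurable_shift (s *: e)).
have msh : measurable (translate (s *: e) @^-1` om p : set LS).
  by rewrite -[X in measurable X]setTI; exact: (measurable_shift _ measurableT (mom p)).
apply: (@le_trans _ _ (\int[mu]_(x in om p.+1)
    (`|dq k (translate (s *: e) x) - dq k' (translate (s *: e) x)|)%:E)%E).
  apply: ge0_subset_integral; [exact: msh|exact: mom| |by []|exact: sub].
  exact: measurable_funTS mgs.
have mZ : measurable_fun (om p.+1 : set LS) (fun x => (`|emb Z x|)%:E).
  apply/measurable_EFinP; apply: (measurableT_comp (@normr_measurable R setT)).
  apply: measurable_funS (emb_measurable bfsX Z); [exact: open_lebn|exact: om_Omega].
have aeE : ae_eq mu (om p.+1 : set LS)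
    (fun x => (`|dq k (translate (s *: e) x) - dq k' (translate (s *: e) x)|)%:E)
    (fun x => (d^-1%:E * (`|emb Z x|)%:E)%E).
  move: ZE; rewrite /ae_on; apply: filterS => x h xp; rewrite h; last exact: om_Omega xp.
  by rewrite indicE mem_set// mul1r -EFinM normrM (gtr0_norm d0) mulKf ?gt_eqF.
have dV0 : (0 <= d^-1%:E)%E by rewrite lee_fin invr_ge0 ltW.
have mdZ : measurable_fun (om p.+1 : set LS)
    (fun x => (d^-1%:E * (`|emb Z x|)%:E)%E).
  exact: (emeasurable_funM (measurable_cst _) mZ).
rewrite (ge0_ae_eq_integral (mom p.+1) (measurable_funTS mgs) mdZ _ _ aeE); first last.
- by move=> x _; rewrite mule_ge0.
- by move=> x _; exact: normr_ge0.
rewrite (@ge0_integralZl _ _ _ mu _ (mom p.+1) _ mZ _ _ dV0); last first.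
  by move=> x _; exact: normr_ge0.
apply: (@le_trans _ _ (d^-1%:E * (r * d)%:E)%E); first by rewrite lee_wpmul2l.
by rewrite -EFinM lee_fin mulrC mulfK// gt_eqF.
Qed.

Definition dual_ball := {l : {linear V -> R^o} | dual_unit_ball l}.
Implicit Types i : dual_ball.

Lemma dominated_integrable_on f g (A : set LS) : measurable_on Omega f ->
  Xmem g -> ae_on Omega (fun x => `|f x| <= g x) ->
  measurable A -> A `<=` Omega -> (mu A < +oo)%E ->
  (\int[mu]_(x in A) (`|f x|)%:E < +oo)%E.
Proof.
move=> mf [phi phig] fg mA AO Aoo.
have [D D0 hD] := bfs_P4 bfsX mA AO Aoo.
have gphi : (Xnorm g <= `|phi|%:E)%E by rewrite (XnormE bfsX phig).
have [Xf _] := le_Xnorm bfsX mf gphi (ltry _) fg.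
apply: (le_lt_trans (hD _ Xf)).
have mfA : measurable_on Omega (fun x => f x * \1_A x).
  exact: (measurable_funM mf (measurable_indic mA)).
have [|_ h] := le_Xnorm bfsX mfA gphi (ltry _).
  apply: ae_onS fg => x _; apply: le_trans.
  by rewrite normrM ler_piMr// indicE; case: (_ \in _); rewrite ?normr1 ?normr0.
by rewrite (@le_lt_trans _ _ (D%:E * `|phi|%:E)%E) ?lee_wpmul2l ?lee_fin ?(ltW D0)// -EFinM ltry.
Qed.

Lemma linear_comp_le i : ae_on Omega (fun x => `|(sval i \o u) x| <= `|u x|).
Proof. by apply: ae_onW => x _; apply: dual_unit_ball_le; exact: (svalP i). Qed.

Lemma Xmem_linear_comp i : Xmem (sval i \o u).
Proof.
have [_ Xu'] := Xu; have [phi phiu] := Xu'.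
have uphi : (Xnorm (fun x => `|u x|)%R <= `|phi|%:E)%E by rewrite (XnormE bfsX phiu).
by have [] := le_Xnorm bfsX (linear_comp_measurable (svalP i)) uphi (ltry _)
  (linear_comp_le i).
Qed.

Local Notation dq i := (diff_quotient Omega j (sval i \o u)).

Lemma measurable_dq i k : measurable_fun setT (dq i k : LS -> R).
Proof. exact/measurable_diff_quotient/linear_comp_measurable/(svalP i). Qed.

Lemma diff_quotient_limit i : exists w : T -> R, measurable_on Omega w /\
  forall p r, 0 < r -> exists N, forall k, (N <= k)%N ->
    (\int[mu]_(x in om p) (`|dq i k x - w x|)%:E <= r%:E)%E.
Proof.
have mO : measurable (Omega : set LS) by exact: open_lebn.
have mom q : measurable (om q : set LS) by exact: om_measurable.
have [w [_ [mw _ _ hw]]] := L1loc_complete (@lebn_complete R n) mO mom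
  (@om_Omega _ _ Omega) (@om_sub _ _ Omega) (om_cover openOmega)
  (fun k => measurable_funTS (measurable_dq i k))
  (fun p r r0 => diff_quotient_cauchy p (svalP i) r0).
by exists w.
Qed.

Lemma le_seqmax_dist (v w : dual_ball -> T -> R) (s : seq dual_ball) x :
  `|seqmax v s x - seqmax w s x| <= \sum_(i <- s) `|v i x - w i x|.
Proof.
elim: s => [|i s IH]; first by rewrite /seqmax !big_nil subrr normr0.
rewrite !seqmax_cons big_cons.
have := ler_dist_dist (v i x) (w i x); move: IH.
rewrite !ler_norml /Num.max; set a := seqmax _ _ _; set b := seqmax _ _ _.
by case: ifPn; case: ifPn; rewrite -?leNgt; lra.
Qed.

(** The condition [p < k] keeps the step strictly below the margin of [om p], so that the hypothesis
    on translations applies there and the zero extensions agree with shifts of [u]. *)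
Lemma Xnorm_seqmax_dq (s : seq dual_ball) p k : (p < k)%N ->
  (Xnorm (fun x => \1_(om p) x * seqmax (fun i => dq i k) s x)%R <= C%:E)%E.
Proof.
move=> pk; have d0 := @dlen_gt0 R k.
have dkp : dlen k < dlen p :> R.
  by rewrite ltf_pV2 ?posrE ?exprn_gt0// ltr_eXn2l// ltr1n.
have h1 : `|0 : R| < dlen p by rewrite normr0 dlen_gt0.
have h2 : `|dlen k : R| < dlen p by rewrite gtr0_norm.
have osc := translation_osc h1 h2; set U := (fun x => `|_ *: _|) in osc.
have XU : Xmem U by apply: Xnorm_lty_mem; rewrite (le_lt_trans osc)// ltry.
have UC : (Xnorm (fun x => (dlen k)^-1 * U x)%R <= C%:E)%E.
  rewrite (XnormZ bfsX _ XU) ger0_norm ?invr_ge0 ?(ltW d0)//.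
  apply: (@le_trans _ _ ((dlen k)^-1%:E * (C * dlen k)%:E)%E).
    rewrite lee_wpmul2l ?lee_fin ?invr_ge0 ?(ltW d0)//.
    by move: osc; rewrite subr0 (gtr0_norm d0).
  by rewrite -EFinM lee_fin mulrCA mulVf ?mulr1// gt_eqF.
have mom : measurable (om p : set LS) by exact: om_measurable.
have mM : measurable_on Omega (seqmax (fun i => dq i k) s).
  by apply: seqmax_measurable => i; exact: measurable_funTS (measurable_dq i k).
have mM' : measurable_on Omega (fun x => \1_(om p) x * seqmax (fun i => dq i k) s x).
  exact: (measurable_funM (measurable_indic mom) mM).
have [|_ //] := le_Xnorm bfsX mM' UC (ltry _).
apply: ae_onW => x _; rewrite /U indicE.
have [xp|xp] := pselect (om p x); last first.
  by rewrite memNset// mul0r scale0r !normr0 mulr0.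
rewrite mem_set// mul1r scale1r ger0_norm ?seqmax_ge0//.
apply: bigmax_le => [|i _].
  by rewrite mulr_ge0// invr_ge0 ltW.
rewrite /diff_quotient normrM gtr0_norm ?invr_gt0// ler_pM2l ?invr_gt0//.
rewrite !(om_translation xp) ?norm_stdvec ?(ltW h1) ?(ltW h2)//.
rewrite -[X in zext _ _ X - _](_ : x + dlen k *: e = _)//.
rewrite -[X in _ - zext _ _ X]addr0 -(scale0r e).
rewrite !(zext_om _ xp) ?norm_stdvec ?(ltW h1) ?(ltW h2)//.
by rewrite -linearB; apply: dual_unit_ball_le; exact: (svalP i).
Qed.

(** The Fatou property is used twice: on a fixed [om p] along a subsequence of scales, then along
    the exhaustion. *)
Lemma Xnorm_seqmax_limit (w : dual_ball -> T -> R) (s : seq dual_ball) :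
  (forall i, measurable_on Omega (w i)) ->
  (forall i p r, 0 < r -> exists N, forall k, (N <= k)%N ->
    (\int[mu]_(x in om p) (`|dq i k x - w i x|)%:E <= r%:E)%E) ->
  (Xnorm (seqmax w s) <= C%:E)%E.
Proof.
move=> mw hw.
have mO : measurable (Omega : set LS) by exact: open_lebn.
have mom q : measurable (om q : set LS) by exact: om_measurable.
have mM : measurable_on Omega (seqmax w s) by exact: seqmax_measurable.
have mMp p : measurable_on Omega (fun x => \1_(om p) x * seqmax w s x).
  exact: (measurable_funM (measurable_indic (mom p)) mM).
have local p : (Xnorm (fun x => \1_(om p) x * seqmax w s x)%R <= C%:E)%E.
  (* This sum dominates the change of the maximum, and its L^1 convergence gives one subsequence
     that works for all functionals in [s]. The offset [p.+1] ensures scales finer than 2^-p. *)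
  pose b k x := \sum_(i <- s) `|dq i (k + p.+1)%N x - w i x|.
  have md i k : measurable_fun (om p : set LS) (fun x => `|dq i k x - w i x|).
    apply: (measurableT_comp (@normr_measurable R setT)).
    apply: (measurable_funB (measurable_funTS (measurable_dq i k))).
    exact: (measurable_funS mO (@om_Omega _ _ Omega p) (mw i)).
  have mb k : measurable_fun (om p : set LS) (b k).
    exact: (measurable_sum _ (fun i => md i _)).
  have ib r : 0 < r -> exists N, forall k, (N <= k)%N ->
      (\int[mu]_(x in om p) (b k x)%:E <= r%:E)%E.
    rewrite /b; elim: (s) r => [|i t IH] r r0.
      exists 0%N => k _; under eq_integral do rewrite big_nil.
      by rewrite integral0 lee_fin ltW.
    have r20 : 0 < r / 2 by rewrite divr_gt0.
    have [N1 h1] := hw i p _ r20; have [N2 h2] := IH _ r20.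
    exists (maxn N1 N2) => k; rewrite geq_max => /andP[k1 k2].
    under eq_integral do rewrite big_cons EFinD.
    have mt : measurable_fun (om p : set LS)
        (fun x => \sum_(m <- t) `|dq m (k + p.+1)%N x - w m x|).
      exact: (measurable_sum _ (fun m => md m _)).
    have t0 x : 0 <= \sum_(m <- t) `|dq m (k + p.+1)%N x - w m x|.
      by apply: sumr_ge0.
    rewrite ge0_integralD; first last.
    - exact/measurable_EFinP/mt.
    - by move=> x _; exact: t0.
    - exact/measurable_EFinP/md.
    - by move=> x _; exact: normr_ge0.
    - exact: mom.
    rewrite [r]splitr EFinD leeD//; last exact: h2.
    by apply: h1; rewrite (leq_trans k1)// leq_addr.
  have [sigma hs] := L1_cvg0_ae_subseq (mom p) mb
    (fun k x _ => sumr_ge0 _ (fun i _ => normr_ge0 _)) ib.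
  apply: (@Xnorm_fatou _ _ _ _ _ bfsX
    (fun k x => \1_(om p) x * seqmax (fun i => dq i (sigma k + p.+1)%N) s x)) => //.
  - move=> k; apply: (measurable_funM (measurable_indic (mom p))).
    by apply: seqmax_measurable => i; exact: measurable_funTS (measurable_dq i _).
  - by move=> k x _; rewrite mulr_ge0 ?seqmax_ge0.
  - by move=> k; apply: Xnorm_seqmax_dq; rewrite leq_addl.
  - move: hs; rewrite /ae_on; apply: filterS => x hx _.
    have [xp|xp] := pselect (om p x); last first.
      by rewrite indicE memNset// mul0r; under eq_fun do rewrite mul0r; exact: cvg_cst.
    rewrite indicE mem_set//; under eq_fun do rewrite mul1r.
    rewrite mul1r; apply/cvgrPdist_le => r r0.
    have /cvgrPdist_le/(_ _ r0) := hx xp; apply: filterS => k /=.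
    rewrite sub0r normrN => /(le_trans (ler_norm _)); apply: le_trans.
    by rewrite distrC; exact: le_seqmax_dist.
apply: (@Xnorm_fatou _ _ _ _ _ bfsX (fun p x => \1_(om p) x * seqmax w s x)) => //.
- by move=> k x _; rewrite mulr_ge0 ?seqmax_ge0.
- apply: ae_onW => x Ox; have [p _ xp] := om_cover openOmega Ox.
  apply/cvgrPdist_le => r r0; exists p => // k /= pk.
  by rewrite indicE mem_set ?mul1r ?subrr ?normr0 ?ltW//; exact: le_om xp.
Qed.

(** The majorant [g] is obtained before the weak derivatives: it places each limit [w i] in X and,
    by (P4), in L^1_loc, as [weak_partial_of_diff_quotient] requires. *)
Lemma partial_upper_gradient : exists (g : T -> R) (w : dual_ball -> T -> R),
  [/\ forall x, 0 <= g x, (Xnorm g <= C%:E)%E &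
   forall i, [/\ ae_on Omega (fun x => `|w i x| <= g x), Xmem (w i) &
     weak_partial Omega j (sval i \o u) (w i)]].
Proof.
have [w hw] := choice diff_quotient_limit.
have mw i : measurable_on Omega (w i) by case: (hw i).
have lw i := (hw i).2.
have [g [g0 gC wg]] := essential_supremum openOmega bfsX mw
  (fun s => Xnorm_seqmax_limit s mw lw).
exists g, w; split=> // i.
have Xg : Xmem g by apply: Xnorm_lty_mem; rewrite (le_lt_trans gC)// ltry.
split=> //; first by have [] := le_Xnorm bfsX (mw i) gC (ltry _) (wg i).
apply: weak_partial_of_diff_quotient => //.
- exact: linear_comp_measurable (svalP i).
- move=> p; apply: (dominated_integrable_on
    (linear_comp_measurable (svalP i)) Xu.2 (linear_comp_le i)).
  + exact: om_measurable.
  + exact: om_Omega.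
  + exact: om_finite.
- split=> // K cK KO; apply/integrableP; split.
    apply/measurable_EFinP; exact: (measurable_funS (open_lebn openOmega) KO (mw i)).
  apply: (dominated_integrable_on (mw i) Xg (wg i)) => //.
    by apply: closed_lebn; apply: compact_closed => //; exact: norm_hausdorff.
  by apply: bounded_lebn; exact: compact_bounded.
- exact: lw.
Qed.

End difference_quotients.

(** * The upper gradient from the partial bounds *)

Unset Implicit Arguments.

Theorem theorem3p15 (R : realType) (n : nat) (Omega : set 'rV[R]_n.+1)
    (V : completeNormedModType R)
    (X : completeNormedModType R) (emb : X -> 'rV[R]_n.+1 -> R)
    (openOmega : open Omega)
    (bfsX : banach_function_space Omega emb)
    (rnpX : radon_nikodym_property X)
    (u : 'rV[R]_n.+1 -> V) (C : R)
    (Xu : XVmem Omega emb u)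
    (C_ge0 : 0 <= C)
    (uC : forall (j : 'I_n.+1) (omega : set 'rV[R]_n.+1) (s t : R),
      compactly_contained omega Omega ->
      ((Num.max `|t| `|s|)%:E < set_dist omega (boundary Omega))%E ->
      (XVnorm_on Omega emb omega
         (fun x => translation Omega (t *: stdvec j) u x
                 - translation Omega (s *: stdvec j) u x)%R
       <= (C * `|t - s|)%:E)%E) :
  R1X Omega emb u /\
  exists g, reshetnyak_upper_gradient Omega emb u g /\
    (Xnorm Omega emb g <= (n.+1%:R * C)%:E)%E.
Proof.
have [g hg] := choice (fun j => partial_upper_gradient openOmega bfsX rnpX Xu C_ge0 (uC j)).
have [w {}hg] := choice hg.
have g0 j x : 0 <= g j x by case: (hg j) => /(_ x).
have gC j : (Xnorm Omega emb (g j) <= C%:E)%E by case: (hg j).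
have wE j i := let: And3 _ _ h := hg j in h i.
pose G x := \sum_(j < n.+1) g j x.
have GC : (Xnorm Omega emb G <= (n.+1%:R * C)%:E)%E.
  have := Xnorm_sum_le bfsX (index_enum 'I_n.+1) gC.
  by rewrite -sum1_size sum1_card card_ord.
have XG : Xmem Omega emb G by apply: Xnorm_lty_mem; rewrite (le_lt_trans GC)// ltry.
pose Df i x : 'rV[R]_n.+1 := \row_j w j i x.
have wDf (i : dual_ball V) : weak_gradient Omega (sval i \o u) (Df i).
  move=> j; rewrite (_ : (fun x => Df i x 0 j) = w j i); first by case: (wE j i).
  by apply/funext => x; rewrite mxE.
have ug : reshetnyak_upper_gradient Omega emb u G.
  split=> // [x _|l ll]; first by apply: sumr_ge0 => j _.
  pose i : dual_ball V := exist _ l ll; exists (Df i); split; first exact: wDf.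
  (* The finitely many coordinates are indexed by natural numbers, vacuously beyond [n], so that the
     countable intersection of a.e. statements applies. *)
  have wg m : {ae @lebn R n, forall x, forall j : 'I_n.+1, val j = m ->
      Omega x -> `|w j i x| <= g j x}.
    have [mn|nm] := ltnP m n.+1.
      have [h _ _] := wE (Ordinal mn) i; move: h; rewrite /ae_on.
      apply: filterS => x h j jm Ox.
      have -> : j = Ordinal mn by apply: val_inj.
      exact: h.
    by apply: aeW => x j jm; have := ltn_ord j; rewrite [nat_of_ord j]jm ltnNge nm.
  have := ae_foralln wg; rewrite /ae_on; apply: filterS => x h Ox.
  rewrite (le_trans (enorm_le_sum _))//.
  by apply: ler_sum => j _; rewrite mxE (h (val j) j).
split; last by exists G.
split=> //; last by exists G.
move=> l ll; pose i : dual_ball V := exist _ l ll.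
split; first exact: (Xmem_linear_comp openOmega bfsX Xu i).
exists (Df i); split; first exact: wDf.
move=> j; rewrite (_ : (fun x => Df i x 0 j) = w j i); first by case: (wE j i).
by apply/funext => x; rewrite mxE.
Qed.
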